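(* Let $M$ be a positive integer, let $U:\mathcal{P}(\Sigma^{\mathbb{N}})\to\mathbb{R}^M$ be continuous with respect to the weak topology, let $\Lambda:\Sigma^{\mathbb N}\to\mathbb R$ satisfy conditions (C1)–(C3) of the context, and let $C\subseteq\mathbb{R}^M$ be a closed subset of $\mathbb R^M$. Assume that $\underline f^{U,\Lambda}$ is inner continuous at $C$. (1) We have $$\sigma_{\mathrm{ab}}\big(\zeta_C^{U,\Lambda}\big)=\underline f^{U,\Lambda}(C).$$ (2) We have $$\sigma_{\mathrm{ab}}\big(\zeta_C^{U,\Lambda}\big)=\sup_{\mu\in\mathcal{P}_S(\Sigma^{\mathbb{N}}),\ U\mu\in C}-\frac{h(\mu)}{\int\Lambda\,d\mu}.$$
   Context: Fix a positive integer $N$. $\Sigma^n=\{1,\ldots,N\}^n$; $\Sigma^*=\bigcup_{n\ge1}\Sigma^n$ (finite strings); $\Sigma^{\mathbb N}=\{1,\ldots,N\}^{\mathbb N}$ (infinite strings, product topology). $|\mathbf{i}|$ is the length of $\mathbf{i}\in\Sigma^*$; $\mathbf{i}|n=i_1\ldots i_n$ for $\mathbf{i}\in\Sigma^{\mathbb N}$; $[\mathbf{i}]=\{\mathbf{j}\in\Sigma^{\mathbb N}:\mathbf{j}|n=\mathbf{i}\}$ for $\mathbf{i}\in\Sigma^n$. $S:\Sigma^{\mathbb N}\to\Sigma^{\mathbb N}$ is the shift. $\mathcal P(\Sigma^{\mathbb N})$ is the set of Borel probability measures on $\Sigma^{\mathbb N}$ with the weak topology, $\mathcal P_S(\Sigma^{\mathbb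 N})$ the subset of shift-invariant ones, and $h(\mu)$ the entropy of $\mu\in\mathcal P_S(\Sigma^{\mathbb N})$. Conditions on $\Lambda$: (C1) $\Lambda$ is continuous; (C2) there are constants $-\infty<c_{\min}\le c_{\max}<0$ with $c_{\min}\le\Lambda\le c_{\max}$; (C3) there is a constant $c\ge1$ such that for all positive integers $n$ and all $\mathbf{i},\mathbf{j}\in\Sigma^{\mathbb N}$ with $\mathbf{i}|n=\mathbf{j}|n$, $\frac1c\le\frac{\exp\sum_{k=0}^{n-1}\Lambda(S^k\mathbf{i})}{\exp\sum_{k=0}^{n-1}\Lambda(S^k\mathbf{j})}\le c$. For $\mathbf{i}\in\Sigma^n$, $s_{\mathbf{i}}=\sup_{\mathbf{k}\in[\mathbf{i}]}\exp\sum_{k=0}^{n-1}\Lambda(S^k\mathbf{k})$ (so the empty string has value $1$). For $\mathbf{i}\in\Sigma^{\mathbb N}$, $L_n\mathbf{i}=\frac1n\sum_{k=0}^{n-1}\delta_{S^k\mathbf{i}}\in\mathcal P(\Sigma^{\mathbb N})$, and $UL_n[\mathbf{i}]=\{U(L_n\mathbf{k}):\mathbf{k}\in[\mathbf{i}]\}$. For $C\subseteq \mathbb R^M$, $r>0$, $B(C,r)=\{x\in \mathbb R^M:\operatorname{dist}(x,C)\le r\}$. Zeta-function: $\zeta_C^{U,\Lambda}(s)=\sum_{\mathbf{i}\in\Sigma^*,\,UL_{|\mathbf{i}|}[\mathbf{i}]\subseteq C}s_{\mathbf{i}}^s$ for those complex $s$ for which the series converges absolutely. Abscissa of convergence of $\zeta(s)=\sum_{\mathbf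 i}a_{\mathbf i}^s$ (with $a_{\mathbf i}>0$): $\sigma_{\mathrm{ab}}(\zeta)=\inf\{t\in\mathbb R:\sum_{\mathbf{i}}a_{\mathbf{i}}^t\text{ converges absolutely}\}$. Lower coarse multifractal spectrum: for $\mathbf{i}=i_1\ldots i_n\in\Sigma^*$ let $\widehat{\mathbf{i}}=i_1\ldots i_{n-1}$; for $\delta>0$ write $s_{\mathbf{i}}\approx\delta$ iff $s_{\mathbf{i}}\le\delta<s_{\widehat{\mathbf{i}}}$. For $C\subseteq\mathbb R^M$, $r>0$ let $\Pi_\delta^{U,\Lambda}(C,r)=\{\mathbf{i}\in\Sigma^*:s_{\mathbf{i}}\approx\delta,\ UL_{|\mathbf{i}|}[\mathbf{i}]\subseteq B(C,r)\}$, $N_\delta^{U,\Lambda}(C,r)=|\Pi_\delta^{U,\Lambda}(C,r)|$, $\underline f^{U,\Lambda}(C,r)=\liminf_{\delta\searrow0}\frac{\log N_\delta^{U,\Lambda}(C,r)}{-\log\delta}$ and $\underline f^{U,\Lambda}(C)=\lim_{r\searrow0}\underline f^{U,\Lambda}(C,r)$. Conventions: $\log0=-\infty$, $\sup\varnothing=-\infty$. Inner continuity: for $C\subseteq\mathbb R^M$ and $r>0$ let $I(C,r)=\{x\in C:\operatorname{dist}(x,\partial C)\ge r\}$. A function $\Phi$ from subsets of $\mathbb R^M$ to (extended) real numbers is inner continuous at $C$ if $\Phi(I(C,r))\to\Phi(C)$ as $r\searrow0$. *)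

(* Defs.v *)
From HB Require Import structures.
From mathcomp Require Import all_boot all_order all_algebra.
From mathcomp Require Import all_classical all_reals all_analysis.

Set Implicit Arguments.
Unset Strict Implicit.
Unset Printing Implicit Defensive.

Import Order.TTheory GRing.Theory Num.Theory.
Import numFieldNormedType.Exports.

Local Open Scope classical_set_scope.
Local Open Scope ring_scope.

(* Entropy (Kolmogorov-Sinai) of a transformation of a probability space. *)
Section entropy.
Context d (T : measurableType d) (R : realType).

Definition finite_measurable_partition m (A : 'I_m -> set T) : Prop :=
  [/\ forall j, measurable (A j), trivIset setT A & \bigcup_j A j = setT].

(* The atoms of the join of A, S^-1 A, ..., S^-(n-1) A are indexed by the words
   of length n over the indices of A; the atoms of some words may be empty. *)
Definition join_atom (S : T -> T) m (A : 'I_m -> set T) n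
    (w : {ffun 'I_n -> 'I_m}) : set T :=
  [set x | forall k : 'I_n, A (w k) (iter k S x)].

(* As ln 0 = 0, the usual convention 0 log 0 = 0 holds. *)
Definition join_entropy (mu : probability T R) (S : T -> T) m
    (A : 'I_m -> set T) n : R :=
  \sum_(w : {ffun 'I_n -> 'I_m})
    - (fine (mu (join_atom S A w)) * ln (fine (mu (join_atom S A w)))).

Definition partition_entropy (mu : probability T R) (S : T -> T) m
    (A : 'I_m -> set T) : R :=
  limn (fun n => join_entropy mu S A n / n%:R).

Definition entropy (mu : probability T R) (S : T -> T) : \bar R :=
  ereal_sup [set h | exists m (A : 'I_m -> set T),
    finite_measurable_partition A /\ h = (partition_entropy mu S A)%:E].

End entropy.

(* One-sided sequences over the alphabet 'I_N.+1, with the product topology and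
   the Borel sigma-algebra. *)
Definition symb (N : nat) : Type :=
  {ptws nat -> discrete_topology 'I_N.+1}.

HB.instance Definition _ N := Topological.on (symb N).
HB.instance Definition _ N := isPointed.Build (symb N) (fun=> ord0).
HB.instance Definition _ N := @isMeasurable.Build (sigma_display (@open (symb N)))
  (symb N) <<s @open (symb N) >> (@sigma_algebra0 _ setT (@open (symb N)))
  (@sigma_algebraC _ (@open (symb N)))
  (@sigma_algebra_bigcup _ setT (@open (symb N))).

Section symbolic.
Context (N : nat) (R : realType).

Definition left_shift (x : symb N) : symb N := fun k => x k.+1.

Definition prob_symb : Type := probability (symb N) R.

(* The weak topology is the initial topology of the maps mu |-> \int f dmu, f
   continuous (hence bounded, symb N being compact). *)
Definition weak_eval (mu : prob_symb) :
    prod_topology (fun _ : {f : symb N -> R | continuous f} => R) :=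
  fun f => \int[mu]_x (proj1_sig f x).

HB.instance Definition _ := Choice.on prob_symb.
HB.instance Definition _ :=
  Topological.copy prob_symb (initial_topology weak_eval).

Definition shift_invariant (mu : prob_symb) : Prop :=
  forall A : set (symb N), measurable A -> mu (left_shift @^-1` A) = mu A.

(* n.-1.+1 is n for n > 0, which is the only meaningful case (see empiricalE). *)
Definition empirical (n : nat) (x : symb N) : set (symb N) -> \bar R :=
  mscale ((n.-1.+1%:R : R)^-1)%:nng
    (msum (fun k => \d_(iter k left_shift x)) n.-1.+1).

HB.instance Definition _ n x := Measure.on (empirical n x).

Lemma empirical_setT n x : empirical n x setT = 1%E.
Proof.
rewrite /empirical /mscale /= /msum.
rewrite (eq_bigr (fun=> 1%E)) => [|k _]; last exact: diracT.
by rewrite sumEFin sumr_const card_ord -EFinM mulVf ?pnatr_eq0.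
Qed.

HB.instance Definition _ n x :=
  Measure_isProbability.Build _ _ _ (empirical n x) (empirical_setT n x).

Definition empirical_prob n x : prob_symb := empirical n x.

Lemma empiricalE n x (A : set (symb N)) : (0 < n)%N ->
  empirical_prob n x A =
    ((n%:R^-1)%:E * \sum_(k < n) \d_(iter k left_shift x) A)%E.
Proof. by case: n. Qed.

(* Finite strings over the alphabet; Sigma^* consists of the nonempty ones. *)
Definition string : Type := seq 'I_N.+1.

Definition cylinder (w : string) : set (symb N) :=
  [set x | forall k, (k < size w)%N -> x k = nth ord0 w k].

Definition birkhoff_sum (Lam : symb N -> R) (n : nat) (x : symb N) : R :=
  \sum_(k < n) Lam (iter k left_shift x).

Definition cond_C2 (Lam : symb N -> R) : Prop :=
  exists cmin cmax : R, [/\ cmin <= cmax, cmax < 0 &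
    forall x, cmin <= Lam x <= cmax].

Definition cond_C3 (Lam : symb N -> R) : Prop :=
  exists2 c : R, 1 <= c & forall (n : nat) (x y : symb N), (0 < n)%N ->
    (forall k, (k < n)%N -> x k = y k) ->
    c^-1 <= expR (birkhoff_sum Lam n x) / expR (birkhoff_sum Lam n y) <= c.

Definition s_ (Lam : symb N -> R) (w : string) : R :=
  sup [set expR (birkhoff_sum Lam (size w) x) | x in cylinder w].

(* Abscissa of absolute convergence of the series \sum_(i in D) a_i ^ s. *)
Definition abscissa (I : choiceType) (D : set I) (a : I -> R) : \bar R :=
  ereal_inf [set t%:E | t in [set t : R | summable D (fun i => (a i `^ t)%:E)]].

Section euclidean.
Context (M : nat).
Implicit Types (x y : 'rV[R]_M) (C : set 'rV[R]_M).

(* The norm of the library on 'rV[R]_M is the sup norm. *)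
Definition eucl_dist x y : R := Num.sqrt (\sum_(j < M) (x 0 j - y 0 j) ^+ 2).

(* The distance to the empty set is +oo. *)
Definition dist_to x C : \bar R :=
  ereal_inf [set (eucl_dist x y)%:E | y in C].

Definition thickening C (r : R) : set 'rV[R]_M :=
  [set x | (dist_to x C <= r%:E)%E].

Definition boundary C : set 'rV[R]_M := closure C `\` interior C.

Definition inner_part C (r : R) : set 'rV[R]_M :=
  [set x | C x /\ (r%:E <= dist_to x (boundary C))%E].

Definition inner_continuous (Phi : set 'rV[R]_M -> \bar R) C : Prop :=
  Phi (inner_part C r) @[r --> 0^'+] --> Phi C.

End euclidean.

Section multifractal.
Context (M : nat) (U : prob_symb -> 'rV[R]_M) (Lam : symb N -> R).
Implicit Types (w : string) (C : set 'rV[R]_M).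

Definition UL w : set 'rV[R]_M :=
  [set U (empirical_prob (size w) x) | x in cylinder w].

Definition zeta_strings C : set string :=
  [set w | w != [::] /\ UL w `<=` C].

Definition zeta_abscissa C : \bar R := abscissa (zeta_strings C) (s_ Lam).

Definition approx w (delta : R) : Prop :=
  s_ Lam w <= delta < s_ Lam (take (size w).-1 w).

Definition Pi_ (delta : R) C (r : R) : set string :=
  [set w | [/\ w != [::], approx w delta & UL w `<=` thickening C r]].

Definition N_ (delta : R) C (r : R) : \bar R := counting (Pi_ delta C r).

Definition lower_spectrum_at C (r : R) : \bar R :=
  limf_einf (fun delta : R => lne (N_ delta C r) / (- ln delta)%:E)%E 0^'+.

Definition lower_spectrum C : \bar R :=
  lim (lower_spectrum_at C r @[r --> 0^'+]).

End multifractal.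

End symbolic.

(* Main.v *)
Require Import Defs.
From HB Require Import structures.
From mathcomp Require Import all_boot all_order all_algebra.
From mathcomp Require Import all_classical all_reals all_analysis.
From mathcomp Require Import measurable_realfun.
From mathcomp Require Import ring lra zify.

Import Order.TTheory GRing.Theory Num.Theory.
Import numFieldNormedType.Exports.

Local Open Scope classical_set_scope.
Local Open Scope ring_scope.

(** Let V be the supremum in the second formula. Both formulas follow from
    [abscissa <= V <= spectrum <= abscissa].

    [abscissa <= V] ([zeta_summable]). Suppose that the series diverges at t.
    The sets of strings off which it converges then form a proper filter. Along
    a finer ultrafilter the empirical measures of the strings converge to an
    invariant measure mu with [U mu] in C ([ultra_limit_measure]), and on no set
    of this ultrafilter does the series converge. Let G be continuous and
    positive, with [G (a x)] summing to 1 over the letters a for each x. The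
    products of G along the orbits of the strings of length n sum to 1
    ([sum_g_function]), while the terms of the series are comparable to the
    exponentials of the Birkhoff sums of [t Lam]. Hence the integral of
    [- ln G + t Lam] under mu cannot be negative. Let G approach the conditional
    probability under mu of a letter given the next q ones. The integral of
    [- ln G] then approaches [H (q + 1) - H q], where H q is the entropy of the
    words of length q. A sum over q shows that [h mu + t \int Lam] is
    nonnegative, that is, t is at most V.

    [V <= spectrum] ([lower_spectrum_at_ge]). Let mu be invariant, with [U mu]
    in C. As mu need not be ergodic, consider independent concatenations of long
    blocks distributed according to mu. By Chebyshev's inequality
    ([typical_sequences_card]), about [exp (n h)] of the concatenations of
    length n have empirical measures close to mu ([many_typical_words]). On
    these words [s_] is about [exp (n \int Lam)]. Prolonged by a small
    proportion of their length, they reach a prescribed delta and are counted by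
    [N_]. Here h is the limit of [H q / q], and the entropy of mu, a supremum
    over all partitions, must be compared with it: this is the Kolmogorov-Sinai
    theorem ([entropy_cylinder]), proved by predicting an arbitrary partition
    from finitely many letters.

    [spectrum <= abscissa] ([lower_spectrum_inner_le]). The thickening by
    [r / 2] of the inner part [inner_part C r] is contained in C. The strings
    counted by [N_] for this inner part and this radius are therefore terms of
    the series, and [s_] is of order delta on them. If the series converges at
    t, their number is [O (delta ^ - t)]. The spectrum of each inner part is
    thus at most the abscissa, and inner continuity passes to C. *)

Set Implicit Arguments.
Unset Strict Implicit.
Unset Printing Implicit Defensive.

(** * Sequences and cylinders *)

Definition agree N n (x y : symb N) : Prop := forall k, (k < n)%N -> x k = y k.

Definition pad N (w : string N) : symb N := fun k => nth ord0 w k.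

Section symbolic_space.
Variable N : nat.
Implicit Types (x y : symb N) (w : string N) (n k : nat).

Lemma iter_shift k x : iter k (@left_shift N) x = fun i => x (i + k)%N.
Proof.
elim: k x => [|k IH] x; first by apply/funext => i; rewrite addn0.
by rewrite iterS IH; apply/funext => i; rewrite /left_shift addnS addSn.
Qed.

Lemma cylinder_mkseq n x y : cylinder (mkseq x n) y <-> agree n x y.
Proof.
split=> h k; rewrite ?size_mkseq => kn.
  by have := h k; rewrite size_mkseq nth_mkseq// => ->.
by rewrite nth_mkseq// h.
Qed.

Lemma cylinder_pad w : cylinder w (pad w).
Proof. by []. Qed.

Lemma mkseq_pad w : mkseq (pad w) (size w) = w.
Proof.
by apply: (@eq_from_nth _ ord0); rewrite size_mkseq// => k kw; rewrite nth_mkseq.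
Qed.

Lemma cylinder_eq w x : cylinder w x <-> mkseq x (size w) = w.
Proof.
split=> [h|<-].
  by apply: (@eq_from_nth _ ord0); rewrite size_mkseq// => k kw; rewrite nth_mkseq ?h.
exact/cylinder_mkseq.
Qed.

Lemma nbhs_cylinder x n : nbhs x (cylinder (mkseq x n)).
Proof.
elim: n => [|n IH].
  by apply: filterS filterT => y _; apply/cylinder_mkseq.
have xn : nbhs x [set y : symb N | y n = x n].
  have /(_ x) := @proj_continuous nat (fun=> discrete_topology 'I_N.+1) n.
  move=> /(_ [set x n]); apply.
  by apply: open_nbhs_nbhs; split => //; exact: discrete_open.
apply: filterS (filterI IH xn) => y [/cylinder_mkseq xy /= yx].
by apply/cylinder_mkseq => k; rewrite ltnS leq_eqVlt => /predU1P[->//|/xy].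
Qed.

(** The cylinders around a point form a basis of its neighbourhoods; all
    topology on sequences goes through this. *)
Lemma nbhs_symbP x (A : set (symb N)) :
  nbhs x A <-> exists n, cylinder (mkseq x n) `<=` A.
Proof.
split; last by move=> [n /filterS]; apply; exact: nbhs_cylinder.
pose G := filter_from [set: nat] (fun n => cylinder (mkseq x n)).
have FG : Filter G.
  apply: filter_from_filter; first by exists 0%N.
  move=> m n _ _; exists (maxn m n) => // y /cylinder_mkseq xy.
  by split; apply/cylinder_mkseq => k kn; apply: xy; rewrite leq_max kn ?orbT.
suff : G --> x by move=> /(_ A)/[apply] -[n _]; exists n.
apply/cvg_sup => i; apply/cvg_image.
  apply/seteqP; split => // a _ /=; exists (fun=> a) => //.
move=> B /nbhs_singleton Bx.
exists ((fun f : symb N => f i) @^-1` B) => /=.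
  exists i.+1 => // y /cylinder_mkseq /(_ i (ltnSn i)) => /= <- //.
apply/seteqP; split => [_ [y By <-]//|b Bb]; exists (fun=> b) => //.
Qed.

Lemma open_cylinder w : open (cylinder w).
Proof.
rewrite openE => x /cylinder_eq wx; rewrite /interior -wx.
exact: nbhs_cylinder.
Qed.

Lemma measurable_cylinder w : measurable (cylinder w).
Proof. by apply: sub_sigma_algebra; exact: open_cylinder. Qed.

Lemma continuous_left_shift : continuous (@left_shift N).
Proof.
move=> x A /nbhs_symbP [n nA]; apply/nbhs_symbP; exists n.+1 => y.
move=> /cylinder_mkseq xy; apply: nA; apply/cylinder_mkseq => k kn.
exact: xy.
Qed.

Lemma measurable_continuous_symb (R : realType) (f : symb N -> R) :
  continuous f -> measurable_fun setT f.
Proof.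
move=> cf; apply: (measurability _ (RGenOInfty.measurableE R)) => //.
move=> _ [_ [a ->] <-]; rewrite setTI; apply: sub_sigma_algebra.
by apply: open_comp => [x _|]; [exact: cf|rewrite set_itvE; exact: open_gt].
Qed.

Lemma measurable_left_shift : measurable_fun setT (@left_shift N).
Proof.
apply: (@measurability _ _ _ _ _ _ (@open (symb N))) => //.
move=> _ [A oA <-]; rewrite setTI; apply: sub_sigma_algebra.
by apply: open_comp => // x _; exact: continuous_left_shift.
Qed.

Lemma compact_symb : compact [set: symb N].
Proof.
have := @tychonoff nat (fun=> discrete_topology 'I_N.+1) (fun=> setT).
rewrite (_ : [set f | _] = setT); last by apply/seteqP.
by apply => _; apply: finite_compact; exact: finite_finset.
Qed.

(** Compactness makes a continuous function uniformly continuous, so up to any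
    error it depends on finitely many letters. *)
Lemma uniform_continuity_symb (R : realType) (f : symb N -> R) (e : R) :
  continuous f -> 0 < e ->
  exists n, forall x y, agree n x y -> `|f x - f y| <= e.
Proof.
move=> cf e0; have := compact_symb.
move=> /compact_near_coveringP /(_ nat \oo
  (fun n x => forall y, agree n x y -> `|f x - f y| <= e) _) [].
  move=> x _; have e20 : 0 < e / 2 by rewrite divr_gt0.
  have /nbhs_symbP [n nx] : nbhs x [set y | `|f x - f y| < e / 2].
    by have /cvgrPdist_lt := cf x; apply.
  exists (cylinder (mkseq x n), [set m | (n <= m)%N]) => /=.
    by split; [exact: nbhs_cylinder|exact: nbhs_infty_ge].
  move=> [y m] /= [xy nm] z yz.
  have xz : cylinder (mkseq x n) z.
    apply/cylinder_mkseq => k kn; move/cylinder_mkseq : xy => ->//.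
    by apply: yz; exact: leq_trans nm.
  rewrite -(subrKA (f x)) (le_trans (ler_normD _ _))// (splitr e) lerD//.
    by rewrite distrC ltW// (nx _ xy).
  exact/ltW/nx.
move=> n _ h; exists n => x y; exact: (h n (leqnn n) x I).
Qed.

End symbolic_space.

(** * Masses of cylinders and integrals *)

Section finite_partition.
Context d (T : measurableType d) (R : realType) (mu : probability T R).

Lemma fine_probability (A : set T) : measurable A -> (fine (mu A))%:E = mu A.
Proof. by move=> mA; rewrite fineK// fin_num_measure. Qed.

(** The entropy computations are finite sums of real numbers, whence this
    real-valued form of additivity. *)
Lemma fine_probability_sum (I : finType) (F : I -> set T) (B : set T) :
  (forall i, measurable (F i)) -> trivIset setT F -> \bigcup_i F i = B ->
  \sum_i fine (mu (F i)) = fine (mu B).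
Proof.
move=> mF tF FB; have mB : measurable B.
  rewrite -FB; apply: fin_bigcup_measurable => //; exact: finite_finset.
apply: EFin_inj; rewrite fine_probability// -FB content_fin_bigcup//; last 2 first.
- exact: finite_finset.
- by rewrite FB.
rewrite (_ : setT = [set` index_enum I]); last first.
  by apply/seteqP; split => i //= _; rewrite mem_index_enum.
rewrite -fsbig_seq ?index_enum_uniq// -sumEFin.
by apply: eq_bigr => i _; rewrite fine_probability.
Qed.

Lemma fine_probability_le (A B : set T) : measurable A -> measurable B ->
  A `<=` B -> fine (mu A) <= fine (mu B).
Proof.
move=> mA mB AB; rewrite fine_le ?fin_num_measure//.
by apply: le_measure; rewrite ?inE.
Qed.

Lemma fine_probabilityD (A B : set T) : measurable A -> measurable B ->
  B `<=` A -> fine (mu (A `\` B)) = fine (mu A) - fine (mu B).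
Proof.
move=> mA mB BA; rewrite measureD//; last first.
  by rewrite (le_lt_trans (probability_le1 _ mA))// ltry.
by rewrite setIidr// fineB// fin_num_measure.
Qed.

End finite_partition.

Definition cylm N (R : realType) (mu : prob_symb N R) (w : string N) : R :=
  fine (mu (cylinder w)).

Section cylinder_mass.
Variables (N : nat) (R : realType).
Implicit Types (mu : prob_symb N R) (w : string N).

Lemma cylmE mu w : mu (cylinder w) = (cylm mu w)%:E.
Proof. by rewrite /cylm fine_probability//; exact: measurable_cylinder. Qed.

Lemma cylm_ge0 mu w : 0 <= cylm mu w.
Proof. exact: fine_ge0. Qed.

Lemma cylm_le1 mu w : cylm mu w <= 1.
Proof.
rewrite -lee_fin -cylmE; apply: probability_le1.
exact: measurable_cylinder.
Qed.

Lemma cylinder_tuple_trivIset n :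
  trivIset setT (fun w : n.-tuple 'I_N.+1 => cylinder w).
Proof.
apply/trivIsetP => v w _ _ vw; apply/seteqP; split => // x /=.
move=> [/cylinder_eq + /cylinder_eq]; rewrite !size_tuple => -> /val_inj.
by move/eqP: vw.
Qed.

Lemma cylinder_tuple_cover n :
  \bigcup_(w : n.-tuple 'I_N.+1) cylinder w = [set: symb N].
Proof.
apply/seteqP; split => // x _.
exists [tuple of mkseq x n] => //; exact/cylinder_mkseq.
Qed.

Lemma cylm_nil mu : cylm mu [::] = 1.
Proof.
rewrite /cylm (_ : cylinder _ = setT) ?probability_setT//.
by apply/seteqP; split => // x _ k.
Qed.

Lemma cylm_sum mu n : \sum_(w : n.-tuple 'I_N.+1) cylm mu w = 1.
Proof.
rewrite (fine_probability_sum mu (F := fun w : n.-tuple _ => cylinder w)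
  _ _ (cylinder_tuple_cover n)) ?probability_setT//.
- by move=> w; exact: measurable_cylinder.
- exact: cylinder_tuple_trivIset.
Qed.

Lemma cylm_rcons mu w : \sum_a cylm mu (rcons w a) = cylm mu w.
Proof.
apply: (fine_probability_sum mu (F := fun a => cylinder (rcons w a))).
- by move=> a; exact: measurable_cylinder.
- apply/trivIsetP => a b _ _ ab; apply/seteqP; split => // x /=.
  move=> [xa xb]; have := xa (size w); rewrite xb ?size_rcons//.
  by rewrite !nth_rcons ltnn eqxx ltnSn => /(_ isT)/esym/eqP; rewrite (negbTE ab).
- apply/seteqP; split => [x [a _] xa k kw|x xw].
    by have := xa k; rewrite size_rcons nth_rcons kw ltnW// => ->.
  exists (x (size w)) => // k; rewrite size_rcons nth_rcons ltnS leq_eqVlt.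
  by move=> /predU1P[->|kw]; [rewrite ltnn eqxx|rewrite kw xw].
Qed.

Lemma shift_preimage_cylinder w :
  @left_shift N @^-1` cylinder w = \bigcup_a cylinder (a :: w).
Proof.
apply/seteqP; split => [x xw|x [a _ xw] k kw]; last exact: (xw k.+1).
by exists (x 0%N) => // -[|k] //= kw; rewrite -xw.
Qed.

Lemma fine_shift_preimage mu w :
  fine (mu (@left_shift N @^-1` cylinder w)) = \sum_a cylm mu (a :: w).
Proof.
symmetry; rewrite shift_preimage_cylinder.
apply: (fine_probability_sum mu (F := fun a => cylinder (a :: w))) => //.
  by move=> a; exact: measurable_cylinder.
apply/trivIsetP => a b _ _ ab; apply/seteqP; split => // x /=.
by move=> [xa xb]; have := xa 0%N isT; rewrite (xb 0%N isT) => /esym/eqP /=; rewrite (negbTE ab).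
Qed.

Lemma cylm_cons mu w : shift_invariant mu ->
  \sum_a cylm mu (a :: w) = cylm mu w.
Proof.
move=> imu; rewrite -fine_shift_preimage imu//; exact: measurable_cylinder.
Qed.

Lemma cylinder_pad_le (f : symb N -> R) n e :
  (forall x y, agree n x y -> `|f x - f y| <= e) ->
  forall (w : n.-tuple 'I_N.+1) x, cylinder w x -> `|f x - f (pad w)| <= e.
Proof.
move=> fe w x xw; apply: fe => k kn.
by rewrite /pad; apply: xw; rewrite size_tuple.
Qed.

Lemma integrable_agree mu (f : symb N -> R) n e (D : set (symb N)) :
  measurable_fun setT f ->
  (forall x y, agree n x y -> `|f x - f y| <= e) ->
  measurable D -> mu.-integrable D (EFin \o f).
Proof.
move=> mf fe mD; apply: measurable_bounded_integrable => //.
- by rewrite (le_lt_trans (probability_le1 _ mD))// ltry.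
- exact: measurable_funTS.
- exists (e + \sum_(w : n.-tuple 'I_N.+1) `|f (pad w)|); split.
    exact: num_real.
  move=> M /ltW eM x _ /=; apply: le_trans eM.
  have : cylinder [tuple of mkseq x n] x by exact/cylinder_mkseq.
  move=> /(cylinder_pad_le fe); set w := [tuple of _] => fx.
  rewrite -(subrK (f (pad w)) (f x)) (le_trans (ler_normD _ _))// lerD//.
  by rewrite (bigD1 w)//= lerDl sumr_ge0.
Qed.

(** A continuous function oscillates little on long cylinders, so its integral
    is controlled by the masses of cylinders alone; weak convergence and
    integrals against empirical measures both reduce to cylinders through this
    estimate. *)
Lemma Rintegral_riemann mu (f : symb N -> R) n e :
  measurable_fun setT f ->
  (forall x y, agree n x y -> `|f x - f y| <= e) ->
  `|\int[mu]_x f x - \sum_(w : n.-tuple 'I_N.+1) f (pad w) * cylm mu w| <= e.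
Proof.
move=> mf fe.
have iD D (mD : measurable D) := integrable_agree mu mf fe mD.
have -> : \int[mu]_x f x = \sum_(w : n.-tuple 'I_N.+1) \int[mu]_(x in cylinder w) f x.
  rewrite /Rintegral.
  rewrite -(cylinder_tuple_cover n) (_ : setT = [set` index_enum (n.-tuple 'I_N.+1)]); last first.
    by apply/seteqP; split => i //= _; rewrite mem_index_enum.
  rewrite bigcup_seq integral_bigsetU_EFin//.
  - apply: EFin_inj; rewrite -sumEFin fineK.
      apply: eq_bigr => w _; rewrite fineK//; apply: integrable_fin_num => //; first exact: measurable_cylinder.
      by apply: iD; exact: measurable_cylinder.
    rewrite sum_fin_num; apply/allP => _ /mapP[w _ ->]; apply: integrable_fin_num; first exact: measurable_cylinder.
    by apply: iD; exact: measurable_cylinder.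
  - by move=> w; exact: measurable_cylinder.
  - by rewrite index_enum_uniq.
  - by apply: sub_trivIset (@cylinder_tuple_trivIset n).
  - by apply/measurable_EFinP; apply: measurable_funTS.
rewrite -sumrB (le_trans (ler_norm_sum _ _ _))//.
rewrite -[leRHS]mulr1 -(cylm_sum mu n) mulr_sumr ler_sum// => w _.
have mw : measurable (cylinder w) := measurable_cylinder w.
have ic c : mu.-integrable (cylinder w) (EFin \o cst c).
  by apply: finite_measure_integrable_cst.
rewrite -[X in _ - X](Rintegral_cst mu mw).
rewrite -(RintegralB mw (iD _ mw) (ic (f (pad w)))).
have ifc : mu.-integrable (cylinder w) (EFin \o (fun x => f x - f (pad w))).
  have := integrableB mw (iD _ mw) (ic (f (pad w))).
  by apply: eq_integrable.
rewrite (le_trans (le_normr_Rintegral _ _))//.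
  rewrite -Rintegral_cst//; apply: le_Rintegral => //.
  - exact: integrable_norm.
  - exact: ic.
  - by move=> x xw; exact: (cylinder_pad_le fe).
Qed.

Lemma Rintegral_agree mu (f : symb N -> R) n :
  measurable_fun setT f ->
  (forall x y, agree n x y -> f x = f y) ->
  \int[mu]_x f x = \sum_(w : n.-tuple 'I_N.+1) f (pad w) * cylm mu w.
Proof.
move=> mf fe; apply/eqP; rewrite -subr_eq0 -normr_le0.
by apply: Rintegral_riemann => // x y /fe ->; rewrite subrr normr0.
Qed.

End cylinder_mass.

(** * Weak convergence and empirical measures *)

Section weak_convergence.
Variables (N : nat) (R : realType).
Implicit Types (mu : prob_symb N R) (w : string N).

Lemma cvg_Rintegral_cylm (F : set_system (prob_symb N R)) mu (f : symb N -> R) :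
  Filter F -> (forall w, cylm nu w @[nu --> F] --> cylm mu w) -> continuous f ->
  \int[nu]_x f x @[nu --> F] --> \int[mu]_x f x.
Proof.
move=> FF Fmu cf; apply/cvgrPdist_le => e e0.
have e30 : 0 < e / 3 by rewrite divr_gt0.
have [n fn] := uniform_continuity_symb cf e30.
have mf := measurable_continuous_symb cf.
have : \sum_(w : n.-tuple 'I_N.+1) f (pad w) * cylm nu w @[nu --> F] -->
    \sum_(w : n.-tuple 'I_N.+1) f (pad w) * cylm mu w.
  by apply: cvg_big => [|w _]; [exact: add_continuous|apply: cvgMr; exact: Fmu].
move=> /cvgrPdist_le /(_ _ e30); apply: filterS => nu.
have := Rintegral_riemann mu mf fn; have := Rintegral_riemann nu mf fn.
rewrite !ler_norml; lra.
Qed.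

(** For the weak topology it suffices that the mass of each cylinder
    converges, since every continuous function is a uniform limit of functions
    of finitely many letters. *)
Lemma cvg_weak (F : set_system (prob_symb N R)) mu :
  Filter F -> (forall w, cylm nu w @[nu --> F] --> cylm mu w) -> F --> mu.
Proof.
move=> FF Fmu.
have : {ptws, (@weak_eval N R) @ F --> weak_eval mu}.
  apply/cvg_sup => -[f cf]; apply/cvg_image.
    by apply/seteqP; split => // a _ /=; exists (fun=> a).
  move=> B /(cvg_Rintegral_cylm FF Fmu cf) /= FB.
  exists ((fun g : prod_topology (fun=> R) => g (exist _ f cf)) @^-1` B) => //.
  by apply/seteqP; split => [_ [y By <-]//|b Bb]; exists (fun=> b).
move=> cvgF A /= [_ [[B oB <-] Bmu] BA]; apply: filterS BA _.
by apply: cvgF; exact: open_nbhs_nbhs.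
Qed.

End weak_convergence.

Section empirical_measure.
Variables (N : nat) (R : realType).
Implicit Types (w : string N) (x : symb N).

Lemma sum_cylinder_indic (g : string N -> R) n x :
  \sum_(w : n.-tuple 'I_N.+1) g w * (x \in cylinder w)%:R = g (mkseq x n).
Proof.
rewrite (bigD1 [tuple of mkseq x n])//= big1 ?addr0.
  by rewrite mem_set ?mulr1//; exact/cylinder_mkseq.
move=> w wx; rewrite memNset ?mulr0// => /cylinder_eq; rewrite size_tuple => xw.
by move/eqP : wx; apply; exact/val_inj/esym.
Qed.

Lemma cylm_empirical n x w : (0 < n)%N ->
  cylm (empirical_prob R n x) w =
  n%:R^-1 * \sum_(k < n) (iter k (@left_shift N) x \in cylinder w)%:R.
Proof.
move=> n0; rewrite /cylm empiricalE//.
rewrite (eq_bigr (fun k : 'I_n => ((iter k (@left_shift N) x \in cylinder w)%:R : R)%:E)); last first.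
  by move=> k _; rewrite diracE.
by rewrite sumEFin -EFinM.
Qed.

(** Comparing both sides with a Riemann sum over cylinders avoids integrating
    against a sum of Dirac masses directly. *)
Lemma Rintegral_empirical n x (f : symb N -> R) : (0 < n)%N -> continuous f ->
  \int[empirical_prob R n x]_y f y = n%:R^-1 * birkhoff_sum f n x.
Proof.
move=> n0 cf; apply/eqP; rewrite -subr_eq0 -normr_le0; apply/ler_addgt0Pr => e e0.
rewrite add0r; have e20 : 0 < e / 2 by rewrite divr_gt0.
have [q fq] := uniform_continuity_symb cf e20.
have := Rintegral_riemann (empirical_prob R n x) (measurable_continuous_symb cf) fq.
set r := \sum_(w : _) _.
have -> : r = n%:R^-1 * \sum_(k < n) f (pad (mkseq (iter k (@left_shift N) x) q)).
  rewrite /r; under eq_bigr do rewrite cylm_empirical// mulrCA mulr_sumr.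
  rewrite -mulr_sumr exchange_big/=; congr (_ * _).
  by apply: eq_bigr => k _; exact: (sum_cylinder_indic (f \o @pad N)).
move=> h; rewrite [e]splitr.
rewrite -(subrKA (n%:R^-1 * \sum_(k < n) f (pad (mkseq (iter k (@left_shift N) x) q)))).
rewrite (le_trans (ler_normD _ _))// lerD// -mulrBr -sumrB normrM ger0_norm//.
rewrite mulrC ler_pdivrMr ?ltr0n//.
rewrite (le_trans (ler_norm_sum _ _ _))// (le_trans (ler_sum _ (G := fun=> e / 2) _))//.
  move=> k _; apply: fq => j jq.
  by rewrite /pad nth_mkseq.
by rewrite sumr_const card_ord mulr_natr.
Qed.

End empirical_measure.

(** * Finite entropies and subadditive sequences *)

Section finite_entropy.
Variable R : realType.

Lemma ln_prod (I : Type) (s : seq I) (F : I -> R) : (forall i, 0 < F i) ->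
  ln (\prod_(i <- s) F i) = \sum_(i <- s) ln (F i).
Proof.
move=> F0; elim: s => [|i s IH]; first by rewrite !big_nil ln1.
by rewrite !big_cons lnM ?posrE ?prodr_gt0// IH.
Qed.

(** This is [ln x <= x - 1] at [x = b / a], with the convention [0 ln 0 = 0]. *)
Lemma mul_ln_le (a b : R) : 0 <= a -> 0 <= b -> (0 < a -> 0 < b) ->
  a * ln b - a * ln a <= b - a.
Proof.
move=> a0 b0 ab; have [->|an0] := eqVneq a 0; first by rewrite !mul0r !subr0.
have {}a0 : 0 < a by rewrite lt_neqAle eq_sym an0.
have {}b0 := ab a0.
rewrite -mulrBr -ln_div ?posrE//.
have /le_ln1Dx : -1 < b / a - 1 by rewrite ltrBDr addNr divr_gt0.
rewrite addrC subrK => /(ler_wpM2l (ltW a0))/le_trans; apply.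
by rewrite mulrBr mulr1 mulrC divfK.
Qed.

(** Every upper bound on an entropy below is obtained by choosing a suitable
    comparison distribution [q]. *)
Lemma gibbs_inequality (I : finType) (p q : I -> R) :
  (forall i, 0 <= p i) -> (forall i, 0 <= q i) -> (forall i, 0 < p i -> 0 < q i) ->
  \sum_i q i <= \sum_i p i ->
  \sum_i - (p i * ln (p i)) <= \sum_i - (p i * ln (q i)).
Proof.
move=> p0 q0 pq qp; rewrite -subr_le0 -sumrB.
apply: (@le_trans _ _ (\sum_i (q i - p i))); last by rewrite sumrB subr_le0.
by apply: ler_sum => i _; rewrite opprK addrC mul_ln_le//; exact: pq.
Qed.

Lemma joint_entropy_ge (I J : finType) (p : I -> J -> R) :
  (forall i j, 0 <= p i j) ->
  \sum_i - ((\sum_j p i j) * ln (\sum_j p i j)) <=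
  \sum_i \sum_j - (p i j * ln (p i j)).
Proof.
move=> p0; apply: ler_sum => i _; rewrite mulr_suml -sumrN.
apply: ler_sum => j _; rewrite lerN2.
have [->|pij] := eqVneq (p i j) 0; first by rewrite !mul0r.
have {}pij : 0 < p i j by rewrite lt_neqAle eq_sym pij p0.
rewrite ler_wpM2l// ler_ln ?posrE//; last first.
  by rewrite (lt_le_trans pij)// (bigD1 j)//= lerDl sumr_ge0.
by rewrite (bigD1 j)//= lerDl sumr_ge0.
Qed.

(** Gibbs' inequality for the product of the two marginals. *)
Lemma joint_entropy_le (I J : finType) (p : I -> J -> R) :
  (forall i j, 0 <= p i j) -> \sum_i \sum_j p i j = 1 ->
  \sum_i \sum_j - (p i j * ln (p i j)) <=
  \sum_i - ((\sum_j p i j) * ln (\sum_j p i j)) +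
  \sum_j - ((\sum_i p i j) * ln (\sum_i p i j)).
Proof.
move=> p0 p1.
have pI i j : p i j <= \sum_j p i j by rewrite (bigD1 j)//= lerDl sumr_ge0.
have pJ i j : p i j <= \sum_i p i j by rewrite (bigD1 i)//= lerDl sumr_ge0.
pose q (ij : I * J) := (\sum_j p ij.1 j) * (\sum_i p i ij.2).
rewrite pair_bigA/= (le_trans (gibbs_inequality (q := q) _ _ _ _))//.
- by move=> [i j] /=; rewrite mulr_ge0// sumr_ge0.
- by move=> [i j] /= pij; rewrite mulr_gt0// (lt_le_trans pij).
- rewrite -(pair_bigA _ (fun i j => q (i, j)))/= -(pair_bigA _ p)/= p1.
  rewrite /q/=; under eq_bigr do rewrite -mulr_sumr.
  by rewrite -mulr_suml p1 mul1r exchange_big/= p1.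
- rewrite -(pair_bigA _ (fun i j => - (p i j * ln (q (i, j)))))/=.
  rewrite (eq_bigr (fun i => \sum_j - (p i j * ln (\sum_j p i j)) +
      \sum_j - (p i j * ln (\sum_i p i j)))); last first.
    move=> i _; rewrite -big_split/=; apply: eq_bigr => j _.
    have [->|pij] := eqVneq (p i j) 0; first by rewrite !mul0r oppr0 addr0.
    have {}pij : 0 < p i j by rewrite lt_neqAle eq_sym pij p0.
    by rewrite /q lnM ?posrE ?(lt_le_trans pij)// mulrDr opprD.
  rewrite big_split/= lerD//; first by under eq_bigr do rewrite sumrN -mulr_suml.
  by rewrite exchange_big/=; under eq_bigr do rewrite sumrN -mulr_suml.
Qed.

End finite_entropy.

Section fekete.
Variables (R : realType) (u : nat -> R).
Hypotheses (u0 : forall n, 0 <= u n) (uD : forall m n, u (m + n)%N <= u m + u n).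

Let l := inf [set u n.+1 / n.+1%:R | n in [set: nat]].

Let l_lb n : (0 < n)%N -> l <= u n / n%:R.
Proof.
case: n => // n _; apply: ge_inf; last by exists n.
by exists 0 => _ [m _ <-]; rewrite divr_ge0.
Qed.

(** Divide [n] by [q] with remainder: [u n <= (n / q) u q + M] with [M]
    independent of [n], so [u n / n] is eventually below [u q / q + e]. *)
Lemma fekete : u n / n%:R @[n --> \oo] --> l.
Proof.
apply/cvgrPdist_le => e e0; have e20 : 0 < e / 2 by rewrite divr_gt0.
have [_ [q _ <-] qe] : exists2 x, [set u n.+1 / n.+1%:R | n in [set: nat]] x & x < l + e / 2.
  apply: inf_adherent => //; split; first by exists (u 1%N / 1%:R), 0%N.
  by exists 0 => _ [m _ <-]; rewrite divr_ge0.
(* M bounds [u r] for every remainder r, since the terms are nonnegative. *)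
pose M := \sum_(r < q.+1) u r.
have uq k r : u (k * q.+1 + r)%N <= k%:R * u q.+1 + u r.
  elim: k => [|k IH]; first by rewrite mul0r add0r.
  rewrite mulSn -addnA (le_trans (uD _ _))// -natr1 mulrDl mul1r.
  by rewrite addrAC addrC lerD2l.
near=> n.
have n0 : 0 < n%:R :> R by rewrite ltr0n; near: n; exact: nbhs_infty_gt.
rewrite distrC ger0_norm; last by rewrite subr_ge0 l_lb// -(ltr0n R).
suff : u n / n%:R <= u q.+1 / q.+1%:R + e / 2.
  move: (ltW qe); move: (u q.+1 / _) (u n / _) => a b; rewrite -/l => al ba.
  by rewrite lerBlDr (le_trans ba)// [in leRHS](splitr e) -addrA [leRHS]addrC lerD2r addrC.
rewrite ler_pdivrMr// (divn_eq n q.+1) (le_trans (uq _ _))// -divn_eq mulrDl lerD//.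
  rewrite mulrC -mulrA ler_wpM2l// mulrC ler_pdivlMr ?ltr0n//.
  by rewrite -natrM ler_nat leq_trunc_div.
apply: (@le_trans _ _ M).
  by rewrite /M (bigD1 (Ordinal (ltn_pmod n (ltn0Sn q))))//= lerDl sumr_ge0.
rewrite -ler_pdivrMl//; near: n; exact: nbhs_infty_ger.
Unshelve. all: by end_near. Qed.

Lemma fekete_is_cvg : cvgn (fun n => u n / n%:R).
Proof. by apply/cvg_ex; exists l; exact: fekete. Qed.

Lemma fekete_lim_le n : (0 < n)%N -> limn (fun n => u n / n%:R) <= u n / n%:R.
Proof. by move=> n0; rewrite (cvg_lim _ fekete)// l_lb. Qed.

End fekete.

(** * Entropy of a partition under iteration *)

Section join_entropy.
Context d (T : measurableType d) (R : realType) (mu : probability T R).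

Lemma fine_probability_sumI (I : finType) (F : I -> set T) (B : set T) :
  (forall i, measurable (F i)) -> trivIset setT F -> \bigcup_i F i = setT ->
  measurable B -> \sum_i fine (mu (B `&` F i)) = fine (mu B).
Proof.
move=> mF tF FT mB; apply: fine_probability_sum.
- by move=> i; exact: measurableI.
- by apply: trivIset_setIl.
- by rewrite -setI_bigcupr FT setIT.
Qed.

Variable S : T -> T.
Hypothesis mS : measurable_fun setT S.
Hypothesis invS : forall A, measurable A -> mu (S @^-1` A) = mu A.
Variables (m : nat) (A : 'I_m -> set T).
Hypothesis partA : finite_measurable_partition A.

Lemma measurable_iter k : measurable_fun setT (iter k S).
Proof.
elim: k => [|k IH]; first exact: measurable_id.
by rewrite (_ : iter k.+1 S = S \o iter k S)//; exact: measurableT_comp.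
Qed.

Lemma measurable_iter_preimage k B :
  measurable B -> measurable (iter k S @^-1` B).
Proof. by move=> mB; rewrite -[_ @^-1` _]setTI; exact: measurable_iter. Qed.

Lemma iter_invariant k B : measurable B -> mu (iter k S @^-1` B) = mu B.
Proof.
move=> mB; elim: k => [//|k IH].
rewrite (_ : iter k.+1 S @^-1` B = S @^-1` (iter k S @^-1` B)).
  by rewrite invS//; exact: measurable_iter_preimage.
by apply/seteqP; split => x /=; rewrite -iterSr.
Qed.

Lemma join_atom_bigcap n (w : {ffun 'I_n -> 'I_m}) :
  join_atom S A w = \bigcap_(k : 'I_n) (iter k S @^-1` A (w k)).
Proof. by apply/seteqP; split => x /= h k => [_|]; exact: h. Qed.

Lemma measurable_join_atom n (w : {ffun 'I_n -> 'I_m}) :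
  measurable (join_atom S A w).
Proof.
have [mA _ _] := partA; rewrite join_atom_bigcap.
apply: fin_bigcap_measurable => [|k _]; first exact: finite_finset.
exact: measurable_iter_preimage.
Qed.

Lemma join_atom_trivIset n :
  trivIset setT (fun w : {ffun 'I_n -> 'I_m} => join_atom S A w).
Proof.
have [_ /trivIsetP tA _] := partA.
apply/trivIsetP => v w _ _ /eqP vw; apply/seteqP; split => // x [xv xw].
apply: vw; apply/ffunP => k; apply/eqP/negP => /negP vwk.
by have := tA _ _ I I vwk; apply/eqP/set0P; exists (iter k S x).
Qed.

Lemma join_atom_cover n :
  \bigcup_(w : {ffun 'I_n -> 'I_m}) join_atom S A w = setT.
Proof.
have [_ _ cA] := partA; apply/seteqP; split => // x _.
have h y : exists i, A i y by have := I : setT y; rewrite -cA => -[i]; exists i.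
have [w wP] := choice h.
by exists [ffun k : 'I_n => w (iter k S x)] => // k; rewrite ffunE.
Qed.

Definition ffun_cat n k (u : {ffun 'I_n -> 'I_m}) (v : {ffun 'I_k -> 'I_m}) :
    {ffun 'I_(n + k) -> 'I_m} :=
  [ffun i : 'I_(n + k) => match fintype.split i with inl a => u a | inr b => v b end].

Lemma sum_ffun_cat n k (F : {ffun 'I_(n + k) -> 'I_m} -> R) :
  \sum_w F w = \sum_u \sum_v F (@ffun_cat n k u v).
Proof.
rewrite pair_bigA/= (reindex (fun uv => @ffun_cat n k uv.1 uv.2))//=.
exists (fun w : {ffun 'I_(n + k) -> 'I_m} =>
  ([ffun i : 'I_n => w (lshift k i)], [ffun i : 'I_k => w (rshift n i)])).
  move=> [u v] _ /=; congr pair; apply/ffunP => i; rewrite !ffunE.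
    case: fintype.splitP => j /= e; first by congr (u _); exact/val_inj.
    by have := ltn_ord i; rewrite e ltnNge leq_addr.
  case: fintype.splitP => j /= e.
    by have := ltn_ord j; rewrite -e ltnNge leq_addr.
  by congr (v _); apply/val_inj; rewrite /= (addnI e).
move=> w _; apply/ffunP => i; rewrite ffunE /=.
by case: fintype.splitP => j ij; rewrite ffunE; congr (w _); exact/val_inj.
Qed.

(** A word of length [n + k] describes the first [n] steps by its first part
    and the next [k] steps, started at time [n], by its second part; with
    invariance this gives subadditivity. *)
Lemma join_atom_cat n k (u : {ffun 'I_n -> 'I_m}) (v : {ffun 'I_k -> 'I_m}) :
  join_atom S A (ffun_cat u v) =
  join_atom S A u `&` (iter n S @^-1` join_atom S A v).
Proof.
apply/seteqP; split => [x xw|x [xu xv] i].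
  split=> i.
    have := xw (lshift k i); rewrite ffunE.
    case: fintype.splitP => j /= e; first by rewrite (val_inj e).
    by have := ltn_ord i; rewrite e ltnNge leq_addr.
  have := xw (rshift n i); rewrite ffunE /=.
  case: fintype.splitP => j /= e.
    by have := ltn_ord j; rewrite -e ltnNge leq_addr.
  by rewrite (val_inj (addnI e)) addnC iterD.
rewrite ffunE; case: fintype.splitP => j ->; first exact: xu.
by rewrite addnC iterD; exact: xv.
Qed.

(** The names of lengths [n] and [k] are the marginals of the name of length
    [n + k], the second one because [S] preserves [mu]. *)
Lemma join_entropyD n k :
  join_entropy mu S A (n + k) <= join_entropy mu S A n + join_entropy mu S A k.
Proof.
rewrite /join_entropy sum_ffun_cat.
pose p (u : {ffun 'I_n -> 'I_m}) (v : {ffun 'I_k -> 'I_m}) := fine (mu (join_atom S A u `&` (iter n S @^-1` join_atom S A v))).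
have prow u : \sum_v p u v = fine (mu (join_atom S A u)).
  apply: fine_probability_sumI.
  - by move=> v; apply: measurable_iter_preimage; exact: measurable_join_atom.
  - apply/trivIsetP => v w _ _ vw; apply/seteqP; split => // x [/= xv xw].
    have /trivIsetP/(_ v w I I vw) := @join_atom_trivIset k.
    by apply/eqP/set0P; exists (iter n S x).
  - by rewrite -preimage_bigcup join_atom_cover.
  - exact: measurable_join_atom.
have pcol v : \sum_u p u v = fine (mu (join_atom S A v)).
  rewrite -(iter_invariant n)//; last exact: measurable_join_atom.
  under eq_bigr do rewrite /p setIC.
  apply: fine_probability_sumI.
  - by move=> u; exact: measurable_join_atom.
  - exact: join_atom_trivIset.
  - exact: join_atom_cover.
  - by apply: measurable_iter_preimage; exact: measurable_join_atom.
under eq_bigr do under eq_bigr do rewrite join_atom_cat.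
under [in leRHS]eq_bigr do rewrite -prow.
under [X in _ <= _ + X]eq_bigr do rewrite -pcol.
apply: joint_entropy_le => [u v|]; first exact: fine_ge0.
under eq_bigr do rewrite prow.
rewrite (fine_probability_sum mu _ _ (@join_atom_cover n)).
- by rewrite probability_setT.
- by move=> w; exact: measurable_join_atom.
- exact: join_atom_trivIset.
Qed.

Lemma join_entropy_ge0 n : 0 <= join_entropy mu S A n.
Proof.
apply: sumr_ge0 => w _; rewrite oppr_ge0 mulr_ge0_le0//; first exact: fine_ge0.
apply: ln_le0; rewrite -lee_fin fine_probability; last exact: measurable_join_atom.
by apply: probability_le1; exact: measurable_join_atom.
Qed.

Lemma partition_entropy_is_cvg :
  cvgn (fun n => join_entropy mu S A n / n%:R).
Proof. exact: fekete_is_cvg join_entropy_ge0 join_entropyD. Qed.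

(** By subadditivity the limit defining the entropy of a partition is also an
    infimum. *)
Lemma partition_entropy_le n : (0 < n)%N ->
  partition_entropy mu S A <= join_entropy mu S A n / n%:R.
Proof. exact: fekete_lim_le join_entropy_ge0 join_entropyD _. Qed.

End join_entropy.

(** * Words and local sets *)

Definition cylinder_partition N (j : 'I_N.+1) : set (symb N) :=
  [set x | x 0%N = j].

Definition block_entropy N (R : realType) (mu : prob_symb N R) n : R :=
  \sum_(w : n.-tuple 'I_N.+1) - (cylm mu w * ln (cylm mu w)).

(** Sets determined by finitely many letters, that is, clopen sets. *)
Definition local_set N (C : set (symb N)) : Prop :=
  exists n, forall x y, agree n x y -> C x -> C y.

Section block_entropy.
Variables (N : nat) (R : realType).
Implicit Types (mu : prob_symb N R).

Lemma cylinder_partitionP : finite_measurable_partition (@cylinder_partition N).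
Proof.
split.
- move=> j; rewrite (_ : cylinder_partition j = cylinder [:: j]).
    exact: measurable_cylinder.
  by apply/seteqP; split => [x xj [|k]//|x /(_ 0%N isT)].
- apply/trivIsetP => i j _ _ /eqP ij; apply/seteqP; split => // x [xi xj].
  by apply: ij; rewrite -[i]xi -[j]xj.
- by apply/seteqP; split => // x _; exists (x 0%N).
Qed.

Lemma join_entropy_cylinder mu n :
  join_entropy mu (@left_shift N) (@cylinder_partition N) n = block_entropy mu n.
Proof.
rewrite /join_entropy /block_entropy.
rewrite (reindex (fun w : n.-tuple 'I_N.+1 => [ffun i : 'I_n => tnth w i]))/=.
  apply: eq_bigr => w _; rewrite /cylm (_ : join_atom _ _ _ = cylinder w)//.
  apply/seteqP; split => x xw k.
    rewrite size_tuple => kn; have := xw (Ordinal kn).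
    by rewrite ffunE iter_shift /cylinder_partition/= add0n (tnth_nth ord0).
  rewrite ffunE iter_shift /cylinder_partition/= add0n xw ?size_tuple//.
  by rewrite (tnth_nth ord0).
exists (fun f : {ffun 'I_n -> 'I_N.+1} => [tuple f i | i < n]).
  by move=> w _; apply: eq_from_tnth => i; rewrite tnth_mktuple ffunE.
by move=> f _; apply/ffunP => i; rewrite ffunE tnth_mktuple.
Qed.

Lemma block_entropy_ge0 mu n : 0 <= block_entropy mu n.
Proof.
rewrite -join_entropy_cylinder; apply: join_entropy_ge0.
- exact: measurable_left_shift.
- exact: cylinder_partitionP.
Qed.

Lemma block_entropy_is_cvg mu : shift_invariant mu ->
  block_entropy mu n / n%:R @[n --> \oo] -->
  partition_entropy mu (@left_shift N) (@cylinder_partition N).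
Proof.
move=> imu; rewrite /partition_entropy.
under eq_fun do rewrite -join_entropy_cylinder.
apply: partition_entropy_is_cvg.
- exact: measurable_left_shift.
- exact: imu.
- exact: cylinder_partitionP.
Qed.

Lemma local_set_bigcup (C : set (symb N)) n :
  (forall x y, agree n x y -> C x -> C y) ->
  C = \bigcup_(w in [set w : n.-tuple 'I_N.+1 | C (pad w)]) cylinder w.
Proof.
move=> nC; apply/seteqP; split => [x Cx|x [w /= Cw xw]].
  exists [tuple of mkseq x n]; last exact/cylinder_mkseq.
  by apply: nC Cx => k kn; rewrite /pad nth_mkseq.
by apply: nC Cw => k kn; rewrite xw ?size_tuple.
Qed.

Lemma local_set_measurable (C : set (symb N)) : local_set C -> measurable C.
Proof.
move=> [n /local_set_bigcup ->].
apply: fin_bigcup_measurable => [|w _]; first exact: finite_finset.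
exact: measurable_cylinder.
Qed.

Lemma local_setC (C : set (symb N)) : local_set C -> local_set (~` C).
Proof.
move=> [n nC]; exists n => x y xy Cx Cy; apply: Cx; apply: nC Cy => k kn.
by rewrite xy.
Qed.

Lemma local_setU (C D : set (symb N)) :
  local_set C -> local_set D -> local_set (C `|` D).
Proof.
move=> [n nC] [m mD]; exists (maxn n m) => x y xy.
by move=> [/nC h|/mD h]; [left|right]; apply: h => k kn; apply: xy; rewrite leq_max kn ?orbT.
Qed.

Lemma open_bigcup_local (O : set (symb N)) : open O ->
  O = \bigcup_n [set x | cylinder (mkseq x n) `<=` O].
Proof.
move=> oO; apply/seteqP; split => [x Ox|x [n _ /=]]; last first.
  by apply; exact/cylinder_mkseq.
have /nbhs_symbP [n nO] : nbhs x O by exact: open_nbhs_nbhs.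
by exists n.
Qed.

Lemma local_set_sub_cylinder (O : set (symb N)) n :
  local_set [set x | cylinder (mkseq x n) `<=` O].
Proof.
exists n => x y xy /= xO z yz.
apply: xO; apply/cylinder_mkseq => k kn; rewrite xy//.
by move/cylinder_mkseq : yz; exact.
Qed.

Let approx mu (B : set (symb N)) := measurable B /\ forall e : R, 0 < e ->
  exists2 C, local_set C & (mu ((B `\` C) `|` (C `\` B)) <= e%:E)%E.

Let approxU mu B B' : approx mu B -> approx mu B' -> approx mu (B `|` B').
Proof.
move=> [mB hB] [mB' hB']; split; first exact: measurableU.
move=> e e0; have e20 : 0 < e / 2 by rewrite divr_gt0.
have [C lC BC] := hB _ e20; have [C' lC' BC'] := hB' _ e20.
exists (C `|` C'); first exact: local_setU.
have mC := local_set_measurable lC; have mC' := local_set_measurable lC'.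
rewrite [e]splitr EFinD (le_trans _ (leeD BC BC'))//.
have m1 : measurable ((B `\` C) `|` (C `\` B)) by apply: measurableU; exact: measurableD.
have m2 : measurable ((B' `\` C') `|` (C' `\` B')) by apply: measurableU; exact: measurableD.
apply: le_trans (measureU2 mu m1 m2); apply: le_measure; rewrite ?inE.
- by apply: measurableU; apply: measurableD; exact: measurableU.
- exact: measurableU.
- move=> x [[[Bx|Bx] /not_orP [nC nC']]|[[Cx|Cx] /not_orP [nB nB']]].
  + by left; left.
  + by right; left.
  + by left; right.
  + by right; right.
Qed.

Let approx_local mu C : local_set C -> approx mu C.
Proof.
move=> lC; split; first exact: local_set_measurable.
by move=> e e0; exists C => //; rewrite setDv setU0 measure0 lee_fin ltW.
Qed.

Let approx_bigcup mu (F : nat -> set (symb N)) :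
  (forall i, approx mu (F i)) -> approx mu (\bigcup_i F i).
Proof.
move=> aF; have mF i : measurable (F i) by have [] := aF i.
have mUF : measurable (\bigcup_i F i) by exact: bigcup_measurable.
split=> // e e0; have e20 : 0 < e / 2 by rewrite divr_gt0.
pose G n := \big[setU/set0]_(i < n) F i.
have aG n : approx mu (G n).
  rewrite /G; elim: n => [|n IH].
    by rewrite big_ord0; apply: approx_local; exists 0%N.
  by rewrite big_ord_recr/=; exact: approxU.
have mG n : measurable (G n) by have [] := aG n.
have GF n : G n `<=` \bigcup_i F i by exact: bigsetU_bigcup.
have : mu \o G @ \oo --> mu (\bigcup_i G i).
  apply: nondecreasing_cvg_mu => //; first exact: bigcup_measurable.
  move=> i j ij; apply/subsetPset; rewrite /G.
  by apply: subset_bigsetU.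
have -> : \bigcup_i G i = \bigcup_i F i.
  apply/seteqP; split => [x [n _ /GF]//|x [i _ Fx]].
  by exists i.+1 => //; rewrite /G big_ord_recr; right.
move=> Gcvg.
have [n nG] : exists n, (mu ((\bigcup_i F i) `\` G n) <= (e / 2)%:E)%E.
  have : fine (mu (G n)) @[n --> \oo] --> fine (mu (\bigcup_i F i)).
    apply: fine_cvg; rewrite fine_probability//.
  move=> /cvgrPdist_le /(_ _ e20) [n _ /(_ n (leqnn n))] /= h; exists n.
  rewrite -fine_probability; last exact: measurableD.
  rewrite lee_fin (fine_probabilityD mu mUF (mG n) (@GF n)).
  by rewrite (le_trans (ler_norm _)).
have [_ /(_ _ e20) [C lC CG]] := aG n; exists C => //.
have mC := local_set_measurable lC.
have m1 : measurable ((G n `\` C) `|` (C `\` G n)) by apply: measurableU; exact: measurableD.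
have m2 : measurable (\bigcup_i F i `\` G n) by exact: measurableD.
rewrite [e]splitr EFinD (le_trans _ (leeD nG CG))//.
apply: le_trans (measureU2 mu m2 m1); apply: le_measure; rewrite ?inE.
- by apply: measurableU; exact: measurableD.
- exact: measurableU.
- move=> x [[Fx Cx]|[Cx Fx]].
    by have [Gx|Gx] := pselect (G n x); [right; left|left].
  by right; right; split => // /GF.
Qed.

(** The sets that can be approximated by local sets form a sigma-algebra, and
    it contains the open sets because an open set is a countable union of
    local sets. *)
Lemma local_approximation mu (B : set (symb N)) (e : R) : measurable B -> 0 < e ->
  exists2 C, local_set C & (mu ((B `\` C) `|` (C `\` B)) <= e%:E)%E.
Proof.
move=> mB e0; suff [_] : approx mu B by apply.
move: B mB; apply: smallest_sub.
- split.
  + by apply: approx_local; exists 0%N.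
  + move=> B [mB hB]; rewrite setTD; split; first exact: measurableC.
    move=> e' e'0; have [C lC BC] := hB _ e'0; exists (~` C); first exact: local_setC.
    rewrite (le_trans _ BC)//.
    by rewrite !setDE !setCK setUC [~` C `&` B]setIC [~` B `&` C]setIC.
  + by move=> F aF; exact: approx_bigcup.
- move=> O oO; rewrite (open_bigcup_local oO).
  by apply: approx_bigcup => n; apply: approx_local; exact: local_set_sub_cylinder.
Qed.

End block_entropy.

(** * The first letter generates *)

Section kolmogorov_sinai.
Variables (N : nat) (R : realType) (mu : prob_symb N R).
Hypothesis imu : shift_invariant mu.
Variables (m : nat) (A : 'I_m -> set (symb N)).
Hypothesis partA : finite_measurable_partition A.

(** A partition is predicted, up to an event of small probability, from a
    finite number of letters: approximate each of its members by a local set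
    and take as prediction an index whose approximation contains the point. *)
Lemma partition_local_approximation (e : R) : 0 < e ->
  exists n (b : symb N -> 'I_m),
    [/\ forall x y, agree n x y -> b x = b y,
        measurable [set x | ~ A (b x) x] &
        fine (mu [set x | ~ A (b x) x]) <= e].
Proof.
move=> e0; have [mA tA cA] := partA.
have [j0 _ _] : (\bigcup_j A j) point by rewrite cA.
have m0 : (0 < m)%N by exact: leq_ltn_trans (ltn_ord j0).
have em0 : 0 < e / m%:R by rewrite divr_gt0// ltr0n.
(* Each of the m members contributes an error of at most [e / m]. *)
have /choice [C CP] : forall j, exists C, local_set C /\
    (mu ((A j `\` C) `|` (C `\` A j)) <= (e / m%:R)%:E)%E.
  by move=> j; have [C lC] := local_approximation mu (mA j) em0; exists C.
have /choice [r rP] : forall j, exists n, forall x y, agree n x y -> C j x -> C j y.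
  by move=> j; have [] := CP j.
pose n := \max_(j < m) r j.
have nP j x y : agree n x y -> (x \in C j) = (y \in C j).
  move=> xy; apply/idP/idP => /set_mem h; apply/mem_set; apply: rP h => k kr.
    by apply: xy; apply: leq_trans kr _; exact: leq_bigmax.
  by rewrite xy//; apply: leq_trans kr _; exact: leq_bigmax.
(* Off the union of the sets [D j], exactly the set [C j] with [A j x]
   contains x, and the pick is correct; the default value only concerns
   points of that union. *)
pose b x := odflt j0 [pick j | x \in C j].
have bP x y : agree n x y -> b x = b y.
  by move=> xy; rewrite /b; under eq_pick => j do rewrite (nP j _ _ xy).
pose D j := (A j `\` C j) `|` (C j `\` A j).
have mC j : measurable (C j) by apply: local_set_measurable; have [] := CP j.
have mD j : measurable (D j) by apply: measurableU; exact: measurableD.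
have mbad : measurable [set x | ~ A (b x) x].
  rewrite (_ : mkset _ = \bigcup_j ([set x | b x = j] `\` A j)).
    apply: fin_bigcup_measurable => [|j _]; first exact: finite_finset.
    apply: measurableD => //; apply: local_set_measurable.
    by exists n => x y /bP /= ->.
  by apply/seteqP; split => [x bx|x [j _ [/= ->]]]//; exists (b x).
exists n, b; split => //.
have badD : [set x | ~ A (b x) x] `<=` \big[setU/set0]_(j < m) D j.
  move=> x /= Abx; rewrite -bigcup_seq /=.
  have [j _ Aj] : (\bigcup_j A j) x by rewrite cA.
  move: Abx; rewrite /b; case: pickP => [i /set_mem Ci nA|nC _] /=.
    by exists i; [rewrite /= mem_index_enum|right].
  exists j; first by rewrite /= mem_index_enum.
  by left; split => // Cj; have := nC j; rewrite mem_set.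
rewrite -lee_fin fine_probability//.
apply: (@le_trans _ _ (mu (\big[setU/set0]_(j < m) D j))).
  by apply: le_measure; rewrite ?inE//; exact: bigsetU_measurable.
apply: (@le_trans _ _ (\sum_(j < m) mu (D j))%E).
  elim: (index_enum _) => [|j s IH]; first by rewrite !big_nil measure0.
  rewrite !big_cons (le_trans (measureU2 mu _ _))// ?leeD2l//.
  exact: bigsetU_measurable.
apply: (@le_trans _ _ (\sum_(j < m) (e / m%:R)%:E)%E).
  by apply: lee_sum => j _; have [] := CP j.
by rewrite sumEFin lee_fin sumr_const card_ord -[leLHS]mulr_natr divfK// pnatr_eq0 -lt0n.
Qed.

(** Gibbs' inequality for the joint law of the name of length [n] in [A] and
    of the first [n + q] letters: the comparison law draws the letters from
    [mu], then each symbol of the name as the one predicted by [b], with an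
    error probability [e] spread over all symbols. The prediction errors cost
    [- ln (e / m)] each and are rare. *)
Lemma join_entropy_le_block n q (b : symb N -> 'I_m) (e : R) :
  (forall x y, agree q x y -> b x = b y) ->
  measurable [set x | ~ A (b x) x] -> 0 < e < 1 ->
  join_entropy mu (@left_shift N) A n <= block_entropy mu (n + q) +
    n%:R * (- ln (1 - e) + fine (mu [set x | ~ A (b x) x]) * - ln (e / m%:R)).
Proof.
move=> bq mbad /andP[e0 e1]; have [mA tA cA] := partA.
have [j0 _ _] : (\bigcup_j A j) point by rewrite cA.
have m0 : (0 < m)%N by exact: leq_ltn_trans (ltn_ord j0).
have m0R : 0 < m%:R :> R by rewrite ltr0n.
have mS := @measurable_left_shift N.
pose S := @left_shift N.
(* [rho j i] is the probability of drawing the symbol j when i is predicted. *)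
pose rho (j i : 'I_m) : R := (1 - e) * (j == i)%:R + e / m%:R.
have em0 : 0 < e / m%:R by rewrite divr_gt0.
have rho_gt0 j i : 0 < rho j i.
  by rewrite /rho ltr_wpDl// mulr_ge0// subr_ge0 ltW.
have rho_sum i : \sum_j rho j i = 1.
  rewrite /rho big_split/= (bigD1 i)//= eqxx mulr1 big1 ?addr0; last first.
    by move=> j /negbTE ->; rewrite mulr0.
  by rewrite sumr_const card_ord -[X in _ + X]mulr_natr divfK ?gt_eqF// subrK.
pose w_ (w : (n + q).-tuple 'I_N.+1) k := b (iter k S (pad w)).
pose p (a : {ffun 'I_n -> 'I_m}) (w : (n + q).-tuple 'I_N.+1) :=
  fine (mu (join_atom S A a `&` cylinder w)).
pose Q (a : {ffun 'I_n -> 'I_m}) (w : (n + q).-tuple 'I_N.+1) :=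
  cylm mu w * \prod_(k < n) rho (a k) (w_ w k).
have mat a : measurable (join_atom S A a) by exact: measurable_join_atom.
have mcyl (w : (n + q).-tuple 'I_N.+1) : measurable (cylinder w).
  exact: measurable_cylinder.
have maw a (w : (n + q).-tuple 'I_N.+1) :
  measurable (join_atom S A a `&` cylinder w) by exact: measurableI.
have p_le a w : p a w <= cylm mu w.
  by apply: fine_probability_le => //; exact: subIsetr.
have p0 a w : 0 <= p a w by exact: fine_ge0.
have Q0 a w : 0 <= Q a w.
  by rewrite mulr_ge0 ?cylm_ge0// prodr_ge0// => k _; exact/ltW/rho_gt0.
have pQ a w : 0 < p a w -> 0 < Q a w.
  move=> paw; apply: mulr_gt0; first exact: lt_le_trans (p_le a w).
  by apply: prodr_gt0 => k _; exact: rho_gt0.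
have prow a : \sum_w p a w = fine (mu (join_atom S A a)).
  apply: fine_probability_sumI => //.
  - exact: cylinder_tuple_trivIset.
  - exact: cylinder_tuple_cover.
have pcol w : \sum_a p a w = cylm mu w.
  rewrite /p; under eq_bigr do rewrite setIC.
  apply: fine_probability_sumI => //.
  - exact: join_atom_trivIset.
  - exact: join_atom_cover.
have Qsum : \sum_a \sum_w Q a w = 1.
  rewrite exchange_big/= -(cylm_sum mu (n + q)); apply: eq_bigr => w _.
  rewrite -mulr_sumr -[RHS]mulr1; congr (_ * _).
  rewrite -(bigA_distr_bigA (fun (k : 'I_n) j => rho j (w_ w k)))/=.
  by rewrite big1// => k _; exact: rho_sum.
have psum : \sum_a \sum_w p a w = 1.
  by rewrite exchange_big/= -(cylm_sum mu (n + q)); apply: eq_bigr => w _.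
pose bad (a : {ffun 'I_n -> 'I_m}) w (k : 'I_n) : R := (a k != w_ w k)%:R.
have lnrho j i : - ln (rho j i) <= - ln (1 - e) + (j != i)%:R * - ln (e / m%:R).
  have [->|ji] := eqVneq j i.
    rewrite mul0r addr0 lerN2 ler_ln ?posrE ?subr_gt0//.
    by rewrite /rho eqxx mulr1 lerDl ltW.
  rewrite mul1r /rho (negbTE ji) mulr0 add0r lerDr oppr_ge0.
  by apply: ln_le0; rewrite gerBl ltW.
(* By invariance, the prediction is wrong at time k with the same probability
   as at time 0. *)
have bad_sum (k : 'I_n) : \sum_a \sum_w p a w * bad a w k =
    fine (mu [set x | ~ A (b x) x]).
  rewrite -(iter_invariant mS imu k mbad) pair_bigA/=.
  rewrite -(fine_probability_sum mu (F := fun aw : {ffun 'I_n -> 'I_m} * (n + q).-tuple 'I_N.+1 =>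
    if aw.1 k != w_ aw.2 k then join_atom S A aw.1 `&` cylinder aw.2 else set0)
    (B := (iter k S) @^-1` [set x | ~ A (b x) x])).
  - apply: eq_bigr => -[a w] _ /=; rewrite /bad; case: ifP => _.
      by rewrite mulr1.
    by rewrite mulr0 measure0.
  - by move=> [a w] /=; case: ifP.
  - apply/trivIsetP => -[a w] [a' w'] _ _ /= aw.
    case: ifP => _; rewrite ?set0I//; case: ifP => _; rewrite ?setI0//.
    apply/seteqP; split => // x [[xa xw] [xa' xw']].
    move/negP : aw; apply; apply/eqP; congr pair.
      have /trivIsetP/(_ a a' I I) := @join_atom_trivIset _ _ S _ _ partA n.
      have [//|_ /(_ isT)] := eqVneq a a'.
      by move=> /seteqP[/(_ x (conj xa xa'))].
    have /trivIsetP/(_ w w' I I) := @cylinder_tuple_trivIset N (n + q).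
    have [//|_ /(_ isT)] := eqVneq w w'.
    by move=> /seteqP[/(_ x (conj xw xw'))].
  - have bw (w : (n + q).-tuple 'I_N.+1) x : cylinder w x -> b (iter k S x) = w_ w k.
      move=> xw; apply: bq => i iq; rewrite /S !iter_shift xw ?size_tuple//.
      by have := ltn_ord k; lia.
    apply/seteqP; split => [x [[a w] _ /=]|x /= xbad].
      case: ifP => // akw [xa xw]; rewrite (bw w)// => xA.
      have /trivIsetP/(_ _ _ I I akw) := tA.
      by move=> /seteqP[/(_ (iter k S x) (conj (xa k) xA))].
    have [a _ xa] : (\bigcup_(a : {ffun 'I_n -> 'I_m}) join_atom S A a) x.
      by rewrite join_atom_cover.
    have [w _ xw] : (\bigcup_(w : (n + q).-tuple 'I_N.+1) cylinder w) x.
      by rewrite cylinder_tuple_cover.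
    exists (a, w) => //=; rewrite ifT//; apply/eqP => akw; apply: xbad.
    by rewrite (bw w)// -akw; exact: xa.
apply: (@le_trans _ _ (\sum_a \sum_w - (p a w * ln (p a w)))).
  rewrite /join_entropy; under eq_bigr do rewrite -prow.
  exact: joint_entropy_ge.
rewrite pair_bigA/=.
apply: (le_trans (gibbs_inequality (q := fun aw => Q aw.1 aw.2) _ _ _ _)) => //=.
- by move=> [a w]; exact: pQ.
- by rewrite -(pair_bigA _ Q)/= Qsum -(pair_bigA _ p)/= psum.
rewrite -(pair_bigA _ (fun a w => - (p a w * ln (Q a w))))/=.
have step a w : - (p a w * ln (Q a w)) <= - (p a w * ln (cylm mu w)) +
    \sum_(k < n) (p a w * - ln (1 - e) + p a w * bad a w k * - ln (e / m%:R)).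
  have [->|paw] := eqVneq (p a w) 0.
    by rewrite !mul0r oppr0 add0r sumr_ge0// => k _; rewrite !mul0r addr0.
  have {}paw : 0 < p a w by rewrite lt_neqAle eq_sym paw p0.
  rewrite /Q lnM ?posrE; last 2 first.
  - exact: lt_le_trans (p_le a w).
  - by apply: prodr_gt0 => k _; exact: rho_gt0.
  rewrite mulrDr opprD lerD2l ln_prod; last by move=> k; exact: rho_gt0.
  rewrite mulr_sumr -sumrN; apply: ler_sum => k _.
  by rewrite -mulrN -mulrA -mulrDr ler_wpM2l.
apply: (@le_trans _ _ (\sum_a \sum_w (- (p a w * ln (cylm mu w)) +
    \sum_(k < n) (p a w * - ln (1 - e) + p a w * bad a w k * - ln (e / m%:R))))).
  by apply: ler_sum => a _; apply: ler_sum => w _; exact: step.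
under eq_bigr do rewrite big_split/=.
rewrite big_split/= lerD//.
  rewrite exchange_big/= /block_entropy; apply: ler_sum => w _.
  by rewrite sumrN -mulr_suml pcol.
under eq_bigr do rewrite exchange_big/=.
rewrite exchange_big/= [leRHS](_ : _ = \sum_(k < n)
    (- ln (1 - e) + fine (mu [set x | ~ A (b x) x]) * - ln (e / m%:R))); last first.
  by rewrite sumr_const card_ord mulr_natl.
apply: ler_sum => k _; under eq_bigr do rewrite big_split/=.
rewrite big_split/= lerD//.
  under eq_bigr do rewrite -mulr_suml.
  by rewrite -mulr_suml psum mul1r.
under eq_bigr do rewrite -mulr_suml.
by rewrite -mulr_suml bad_sum.
Qed.

End kolmogorov_sinai.

Section generator_entropy.
Variables (N : nat) (R : realType) (mu : prob_symb N R).
Hypothesis imu : shift_invariant mu.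

Let h := partition_entropy mu (@left_shift N) (@cylinder_partition N).

Lemma block_entropyD n k :
  block_entropy mu (n + k) <= block_entropy mu n + block_entropy mu k.
Proof.
rewrite -!join_entropy_cylinder; apply: join_entropyD.
- exact: measurable_left_shift.
- exact: imu.
- exact: cylinder_partitionP.
Qed.

Lemma partition_entropy_le_block n : (0 < n)%N -> h <= block_entropy mu n / n%:R.
Proof.
rewrite -join_entropy_cylinder; apply: partition_entropy_le.
- exact: measurable_left_shift.
- exact: imu.
- exact: cylinder_partitionP.
Qed.

(** The Kolmogorov-Sinai theorem for the generator given by the first letter. *)
Lemma partition_entropy_le_cylinder m (A : 'I_m -> set (symb N)) :
  finite_measurable_partition A ->
  partition_entropy mu (@left_shift N) A <= h.
Proof.
move=> partA; apply/ler_addgt0Pr => eta eta0.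
have eta20 : 0 < eta / 2 by rewrite divr_gt0.
(* The term [- ln (1 - e)] of [join_entropy_le_block] is then [eta / 2]; the
   accuracy of the prediction below accounts for the other half of eta. *)
pose e := 1 - expR (- (eta / 2)).
have e01 : 0 < e < 1.
  by rewrite /e subr_gt0 expR_lt1 oppr_lt0 eta20 gtrBl expR_gt0.
pose c := - ln (e / m%:R).
have c0 : 0 < `|c| + 1 by rewrite ltr_pwDr.
have [q [b [bq mbad bad]]] := partition_local_approximation mu partA (divr_gt0 eta20 c0).
have mS := @measurable_left_shift N.
have cvgA := @partition_entropy_is_cvg _ _ _ mu _ mS imu _ _ partA.
have cvgH : block_entropy mu n / n%:R + block_entropy mu q / n%:R + eta @[n --> \oo]
    --> h + 0 + eta.
  apply: cvgD; last exact: cvg_cst.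
  apply: cvgD; first exact: block_entropy_is_cvg.
  rewrite -[X in _ --> X](mulr0 (block_entropy mu q)).
  apply: cvgMr; apply/gtr0_cvgV0; last exact: cvgr_idn.
  by near=> n; rewrite ltr0n; near: n; exact: nbhs_infty_gt.
rewrite -(addr0 h); apply: ler_cvg_to cvgA cvgH _.
near=> n.
have n0 : 0 < n%:R :> R by rewrite ltr0n; near: n; exact: nbhs_infty_gt.
rewrite -mulrDl ler_pdivrMr// [leRHS]mulrDl divfK ?gt_eqF//.
rewrite (le_trans (join_entropy_le_block imu partA n bq mbad e01))//.
rewrite lerD ?block_entropyD// mulrC ler_wpM2r ?ler0n//.
rewrite [leRHS]splitr lerD//.
  by rewrite /e opprB addrCA subrr addr0 expRK opprK.
rewrite -/c (le_trans (ler_norm _))// normrM ger0_norm; last exact: fine_ge0.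
rewrite (le_trans (ler_wpM2r _ bad))// -mulrA ler_piMr//; first exact: ltW.
by rewrite mulrC ler_pdivrMr// mul1r lerDl.
Unshelve. all: by end_near. Qed.

(** The supremum over all partitions that defines the entropy is attained at
    the partition given by the first letter, which is the one that counts
    words. *)
Lemma entropy_cylinder : entropy mu (@left_shift N) = h%:E.
Proof.
apply/eqP; rewrite eq_le; apply/andP; split.
  apply: ub_ereal_sup => _ [m [A [partA ->]]].
  by rewrite lee_fin; exact: partition_entropy_le_cylinder.
apply: ereal_sup_ubound; exists N.+1, (@cylinder_partition N).
by split => //; exact: cylinder_partitionP.
Qed.

End generator_entropy.

(** * Measures with prescribed masses of cylinders *)

Section measures_on_cylinders.
Variables (N : nat) (R : realType).

(** Local sets are stable under intersection and generate the Borel sets, so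
    measures can be compared on them. *)
Lemma measurable_symbE : @measurable _ (symb N) = <<s @local_set N >>.
Proof.
apply/seteqP; split; apply: smallest_sub.
- exact: smallest_sigma_algebra.
- move=> O oO; rewrite (open_bigcup_local oO).
  have [_ _ H] := smallest_sigma_algebra setT (@local_set N).
  by apply: H => n; apply: sub_sigma_algebra; exact: local_set_sub_cylinder.
- exact: smallest_sigma_algebra.
- by move=> C; exact: local_set_measurable.
Qed.

Lemma local_setI (C D : set (symb N)) :
  local_set C -> local_set D -> local_set (C `&` D).
Proof.
move=> lC lD; rewrite -[_ `&` _]setCK setCI.
by apply: local_setC; apply: local_setU; exact: local_setC.
Qed.

Lemma measure_local_set (m : {measure set (symb N) -> \bar R}) C n :
  (forall x y, agree n x y -> C x -> C y) ->
  m C = (\sum_(w \in [set w : n.-tuple 'I_N.+1 | C (pad w)]) m (cylinder w))%E.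
Proof.
move=> nC; rewrite [X in m X](local_set_bigcup nC) content_fin_bigcup//.
- exact: finite_finset.
- by apply: sub_trivIset (@cylinder_tuple_trivIset N n).
- by move=> w _; exact: measurable_cylinder.
- by rewrite -local_set_bigcup//; apply: local_set_measurable; exists n.
Qed.

Lemma measure_eq_cylinder (m1 m2 : {measure set (symb N) -> \bar R}) :
  (m1 setT < +oo)%E -> (forall w, m1 (cylinder w) = m2 (cylinder w)) ->
  forall A, measurable A -> m1 A = m2 A.
Proof.
move=> m1oo m12 A mA.
apply: (measure_unique (@local_set N) (fun=> setT) measurable_symbE) => //.
- exact: local_setI.
- by move=> _; exists 0%N.
- by rewrite bigcup_const//; exists 0%N.
- move=> C [n nC]; rewrite !(measure_local_set _ nC).
  by apply: eq_fsbigr => w _; exact: m12.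
Qed.

End measures_on_cylinders.

Section coding.
Variables (N : nat) (R : realType) (p : string N -> R).
Hypotheses (p_ge0 : forall w, 0 <= p w) (p_nil : p [::] = 1)
  (p_rcons : forall w, \sum_a p (rcons w a) = p w).

Let offset (w : string N) (a : nat) : R := \sum_(b < a) p (rcons w (inord b)).

(** The interval coding a word is obtained by successive subdivision: the
    interval of [v] is cut, from left to right, into intervals of lengths [p
    (rcons v a)]. [left_end v w] is the offset of the interval of [v ++ w]
    inside that of [v]. *)
Fixpoint left_end (v w : string N) : R :=
  if w is a :: w' then offset v a + left_end (rcons v a) w' else 0.

Definition code_itv (w : string N) : set R :=
  `[left_end [::] w, left_end [::] w + p w[%classic.

Lemma left_end_rcons v w a :
  left_end v (rcons w a) = left_end v w + offset (v ++ w) a.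
Proof.
elim: w v => [|b w IH] v /=; first by rewrite cats0 addr0 add0r.
by rewrite IH addrA cat_rcons.
Qed.

Lemma offset_max w : offset w N.+1 = p w.
Proof.
rewrite /offset -p_rcons; apply: eq_bigr => b _; by rewrite inord_val.
Qed.

Lemma offsetS w (a : 'I_N.+1) : offset w a.+1 = offset w a + p (rcons w a).
Proof. by rewrite /offset big_ord_recr/= inord_val. Qed.

Lemma offset_le w a b : (a <= b)%N -> offset w a <= offset w b.
Proof.
move=> ab; rewrite -(subnKC ab); elim: (b - a)%N => [|k IH]; first by rewrite addn0.
by rewrite addnS {2}/offset big_ord_recr/= (le_trans IH)// lerDl.
Qed.

Lemma code_itv_rcons w (a : 'I_N.+1) u : code_itv (rcons w a) u <->
  left_end [::] w + offset w a <= u < left_end [::] w + offset w a.+1.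
Proof.
by rewrite /code_itv left_end_rcons cat0s offsetS addrA/= in_itv.
Qed.

Lemma code_itv_sub w a : code_itv (rcons w a) `<=` code_itv w.
Proof.
move=> u /code_itv_rcons /andP[u1 u2]; rewrite /code_itv/= in_itv/=.
rewrite (le_trans _ u1) ?lerDl ?sumr_ge0//= (lt_le_trans u2)// lerD2l.
by rewrite -offset_max offset_le.
Qed.

Lemma code_itv_split w u : code_itv w u -> exists a, code_itv (rcons w a) u.
Proof.
rewrite /code_itv/= in_itv/= => /andP[u1 u2].
have u0 : left_end [::] w + offset w 0 <= u by rewrite /offset big_ord0 addr0.
have uN : u < left_end [::] w + offset w N.+1 by rewrite offset_max.
suff : forall k, (k <= N.+1)%N -> u < left_end [::] w + offset w k ->
    exists a, code_itv (rcons w a) u by move/(_ _ (leqnn _) uN).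
elim=> [_ uk|k IH kN uk]; first by have := lt_le_trans uk u0; rewrite ltxx.
have [ku|ku] := leP (left_end [::] w + offset w k) u.
  by exists (Ordinal kN); apply/code_itv_rcons; rewrite ku.
by apply: IH => //; exact: ltnW.
Qed.

Lemma code_itv_disj w (a b : 'I_N.+1) u :
  code_itv (rcons w a) u -> code_itv (rcons w b) u -> a = b.
Proof.
move=> /code_itv_rcons /andP[a1 a2] /code_itv_rcons /andP[b1 b2].
have := le_lt_trans a1 b2; have := le_lt_trans b1 a2; rewrite !ltrD2l => ba ab.
apply/val_inj/eqP; rewrite eqn_leq; apply/andP; split.
  by rewrite -ltnS ltnNge; apply: contraTN ab => h; rewrite -leNgt offset_le.
by rewrite -ltnS ltnNge; apply: contraTN ba => h; rewrite -leNgt offset_le.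
Qed.

Fixpoint code_word (u : R) n : string N :=
  if n is n'.+1 then
    let w := code_word u n' in
    rcons w (odflt ord0 [pick a | u \in code_itv (rcons w a)])
  else [::].

Lemma size_code_word u n : size (code_word u n) = n.
Proof. by elim: n => //= n IH; rewrite size_rcons IH. Qed.

(** A point of [0, 1[ is sent to the sequence of the letters of the intervals
    containing it. *)
Definition code (u : R) : symb N := fun k => nth ord0 (code_word u k.+1) k.

Lemma mkseq_code u n : mkseq (code u) n = code_word u n.
Proof.
elim: n => [//|n IH]; rewrite mkseqS IH /code/= nth_rcons size_code_word ltnn.
by rewrite eqxx.
Qed.

Lemma code_word_in u n : code_itv [::] u -> code_itv (code_word u n) u.
Proof.
move=> u01; elim: n => [//|n IH] /=; case: pickP => [a /set_mem//|h].
by have [a ua] := code_itv_split IH; have := h a; rewrite mem_set.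
Qed.

Lemma code_itv_nil w : code_itv w `<=` code_itv [::].
Proof.
elim/last_ind: w => [//|w a IH]; exact: subset_trans (@code_itv_sub w a) IH.
Qed.

Lemma code_word_uniq w u : code_itv w u -> code_word u (size w) = w.
Proof.
elim/last_ind: w => [//|w a IH] ua; rewrite size_rcons /=.
rewrite IH; last exact: code_itv_sub ua.
case: pickP => [b /set_mem ub|/(_ a)]; last by rewrite mem_set.
by congr rcons; exact: code_itv_disj ub ua.
Qed.

Lemma code_cylinder w :
  code @^-1` cylinder w `&` code_itv [::] = code_itv w.
Proof.
apply/seteqP; split => [u [/cylinder_eq uw u01]|u uw].
  by rewrite -uw mkseq_code; exact: code_word_in.
split; last exact: code_itv_nil uw.
by apply/cylinder_eq; rewrite mkseq_code; exact: code_word_uniq.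
Qed.

Lemma measurable_code_itv w : measurable (code_itv w).
Proof. exact: measurable_itv. Qed.

Lemma measurable_code : measurable_fun (code_itv [::]) code.
Proof.
apply: (@measurability _ _ _ _ _ _ (@local_set N)); first exact: measurable_symbE.
move=> _ [C [n nC] <-].
rewrite (_ : _ `&` _ =
    \bigcup_(w in [set w : n.-tuple 'I_N.+1 | C (pad w)]) code_itv w).
  apply: fin_bigcup_measurable => [|w _]; first exact: finite_finset.
  exact: measurable_code_itv.
apply/seteqP; split => [u [u01 /= Cu]|u [w /= Cw]].
  exists [tuple of mkseq (code u) n] => /=.
    by apply: nC Cu => k kn; rewrite /pad nth_mkseq.
  by rewrite mkseq_code; exact: code_word_in.
rewrite -code_cylinder => -[uw u01]; split => //=.
by apply: nC Cw => k kn; rewrite /pad uw// size_tuple.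
Qed.

(** The image of the Lebesgue measure of [0, 1[ under [code]. *)
Definition coded_measure (A : set (symb N)) : \bar R :=
  lebesgue_measure (code_itv [::] `&` code @^-1` A).

Let coded0 : coded_measure set0 = 0%E.
Proof. by rewrite /coded_measure preimage_set0 setI0 measure0. Qed.

Let coded_ge0 A : (0 <= coded_measure A)%E.
Proof. exact: measure_ge0. Qed.

Let coded_sigma_additive : semi_sigma_additive coded_measure.
Proof.
move=> F mF tF mUF; rewrite /coded_measure preimage_bigcup setI_bigcupr.
have mI n : measurable (code_itv [::] `&` code @^-1` F n).
  exact: measurable_code (measurable_code_itv [::]) _ (mF n).
apply: measure_semi_sigma_additive; [exact: mI| |by apply: bigcup_measurable => n _; exact: mI].
apply/trivIsetP => i j _ _ ij; move/trivIsetP : tF => /(_ _ _ I I ij) Fij.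
by rewrite setIACA setIid -preimage_setI Fij preimage_set0 setI0.
Qed.

HB.instance Definition _ := isMeasure.Build _ _ _ coded_measure
  coded0 coded_ge0 coded_sigma_additive.

Lemma coded_measure_cylinder w : coded_measure (cylinder w) = (p w)%:E.
Proof.
rewrite /coded_measure setIC code_cylinder /code_itv.
rewrite lebesgue_measure_itv/= lte_fin ltrDl.
have [pw|] := ltP 0 (p w); first by rewrite -EFinD addrAC subrr add0r.
by move=> pw; congr EFin; apply/eqP; rewrite eq_le pw p_ge0.
Qed.

Let coded_setT : coded_measure setT = 1%E.
Proof.
rewrite -[RHS]/((1 : R)%:E) -p_nil -coded_measure_cylinder; congr coded_measure.
by apply/seteqP; split => // x _ k.
Qed.

HB.instance Definition _ := Measure_isProbability.Build _ _ _ coded_measure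
  coded_setT.

(** Kolmogorov's extension theorem for sequences of letters. Coding by nested
    intervals reduces it to the existence of the Lebesgue measure. *)
Lemma cylm_extension : exists mu : prob_symb N R, forall w, cylm mu w = p w.
Proof.
exists (coded_measure : probability _ _) => w.
by rewrite /cylm -[X in fine X]/(coded_measure (cylinder w)) coded_measure_cylinder.
Qed.

End coding.

HB.instance Definition _ N := isMeasurableFun.Build _ _ _ _ (@left_shift N)
  (@measurable_left_shift N).

(** Both [mu] and its image under the shift are determined by their values on
    cylinders. *)
Lemma shift_invariant_cylm N (R : realType) (mu : prob_symb N R) :
  (forall w, \sum_a cylm mu (a :: w) = cylm mu w) -> shift_invariant mu.
Proof.
move=> mu_cons A mA.
apply: (@measure_eq_cylinder _ _ (distribution mu (@left_shift N)) mu) => //.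
  exact: le_lt_trans (probability_le1 _ measurableT) (ltry 1).
move=> w; suff : mu (@left_shift N @^-1` cylinder w) = mu (cylinder w) by [].
rewrite cylmE -mu_cons -fine_shift_preimage fine_probability//.
rewrite -[X in measurable X]setTI; apply: measurable_left_shift => //.
exact: measurable_cylinder.
Qed.

(** * Series over strings *)

Section summable_sets.
Variables (R : realType) (I : choiceType) (a : I -> R).
Hypothesis a_ge0 : forall i, 0 <= a i.

Let esum_ind (A : set I) :
  (\esum_(i in A) `|(a i)%:E| = \esum_(i in setT) ((i \in A)%:R * a i)%:E)%E.
Proof.
rewrite esum_mkcond; apply: eq_esum => i _.
by case: ifP => _; rewrite ?mul1r ?mul0r// gee0_abs// lee_fin.
Qed.

Lemma sub_summable (A B : set I) : A `<=` B ->
  summable B (EFin \o a) -> summable A (EFin \o a).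
Proof.
move=> AB; apply: le_lt_trans; rewrite !esum_ind; apply: le_esum => i _.
rewrite lee_fin ler_wpM2r// ler_nat.
by case: (boolP (i \in A)) => // /set_mem/AB/mem_set ->.
Qed.

Lemma summable_setU (A B : set I) :
  summable A (EFin \o a) -> summable B (EFin \o a) ->
  summable (A `|` B) (EFin \o a).
Proof.
move=> sA sB; apply: le_lt_trans (lte_add_pinfty sA sB).
rewrite !esum_ind -esumD; last 2 first.
- by move=> i _; rewrite lee_fin mulr_ge0.
- by move=> i _; rewrite lee_fin mulr_ge0.
apply: le_esum => i _; rewrite -EFinD lee_fin -mulrDl ler_wpM2r// in_setU.
by case: (i \in A); case: (i \in B); rewrite ?addr0 ?add0r ?lerDl.
Qed.

Lemma finite_set_summable (A : set I) : finite_set A -> summable A (EFin \o a).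
Proof.
move=> fA; rewrite /summable esum_fset//.
by rewrite fsbig_finite//= sumEFin ltry.
Qed.

End summable_sets.

Lemma sum_tuple_cons (R : realType) (T : finType) (F : seq T -> R) n :
  \sum_(w : n.+1.-tuple T) F w = \sum_a \sum_(w : n.-tuple T) F (a :: w).
Proof.
rewrite pair_bigA/= (reindex (fun aw : T * n.-tuple T => cons_tuple aw.1 aw.2))//=.
exists (fun w => (thead w, [tuple of behead w])) => [[a w] _|w _] /=.
  by congr pair; exact/val_inj.
by case/tupleP: w => b w; apply/val_inj.
Qed.

Section strings.
Variables (N : nat) (R : realType).

Lemma esum_strings (h : string N -> R) : (forall w, 0 <= h w) ->
  (\esum_(w in setT) (h w)%:E =
   \sum_(n <oo) (\sum_(w : n.-tuple 'I_N.+1) h w)%:E)%E.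
Proof.
move=> h0.
have -> : setT = \bigcup_n [set w : string N | size w = n].
  by apply/seteqP; split => // w _; exists (size w).
rewrite nneseries_sum_bigcup; last 2 first.
- apply/trivIsetP => i j _ _ /eqP ij; apply/seteqP; split => // w [/= wi wj].
  by apply: ij; rewrite -wi -wj.
- by move=> w; rewrite lee_fin.
apply: eq_eseriesr => n _.
rewrite (@reindex_esum _ _ _ [set: n.-tuple 'I_N.+1] _ (@tval n _)); last first.
  split => [w _|v w _ _ /val_inj//|w /= wn]; first by rewrite /= size_tuple.
  have wn' : size w == n by apply/eqP.
  by exists (Tuple wn').
rewrite esum_fset//; last 2 first.
- exact: finite_finset.
- by move=> w _; rewrite lee_fin.
rewrite (_ : setT = [set` index_enum (n.-tuple 'I_N.+1)]); last first.
  by apply/seteqP; split => i //= _; rewrite mem_index_enum.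
by rewrite -fsbig_seq ?index_enum_uniq// sumEFin.
Qed.

(** Comparison with a geometric series, after grouping the strings by length. *)
Lemma summable_strings (a h : string N -> R) (D : set (string N)) (B z : R) :
  (forall w, 0 <= a w) -> (forall w, 0 <= h w) -> (forall w, D w -> a w <= h w) ->
  0 <= B -> 0 < z < 1 ->
  (forall n, \sum_(w : n.-tuple 'I_N.+1) h w <= B * z ^+ n) ->
  summable D (EFin \o a).
Proof.
move=> a0 h0 ah B0 /andP[z0 z1] hB.
apply: (@le_lt_trans _ _ (B * (1 - z)^-1)%:E); last by rewrite ltry.
apply: (@le_trans _ _ (\esum_(w in setT) (h w)%:E)%E).
  rewrite esum_mkcond; apply: le_esum => w _; case: ifP => [/set_mem Dw|_].
    by rewrite /= ger0_norm// lee_fin ah.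
  by rewrite lee_fin.
rewrite esum_strings//; apply: lime_le.
  by apply: is_cvg_nneseries => n _ _; rewrite lee_fin sumr_ge0.
apply: nearW => n; rewrite sumEFin lee_fin.
apply: le_trans (geometric_le_lim n B0 z0 _); last by rewrite ger0_norm// ltW.
by rewrite /series/=; apply: ler_sum => k _; exact: hB.
Qed.

Lemma shift_pad_cons a (w : string N) : @left_shift N (pad (a :: w)) = pad w.
Proof. by []. Qed.

Lemma birkhoff_sum_cons (f : symb N -> R) a (w : string N) :
  birkhoff_sum f (size w).+1 (pad (a :: w)) =
  f (pad (a :: w)) + birkhoff_sum f (size w) (pad w).
Proof.
rewrite /birkhoff_sum big_ord_recl/=; congr (_ + _).
by apply: eq_bigr => k _; rewrite -iterS iterSr.
Qed.

(** Summing over the first letter first, each factor contributes 1 in turn.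
    The words are prolonged by a constant tail that is never summed over, so
    that the identity is exact and no boundary term appears. *)
Lemma sum_g_function (G : symb N -> R) n : (forall x, 0 < G x) ->
  (forall w : string N, \sum_a G (pad (a :: w)) = 1) ->
  \sum_(w : n.-tuple 'I_N.+1) expR (birkhoff_sum (fun x => ln (G x)) (size w) (pad w)) = 1.
Proof.
move=> G0 G1; elim: n => [|n IH].
  rewrite (bigD1 [tuple])//= big1 ?addr0.
    by rewrite /birkhoff_sum big_ord0 expR0.
  by move=> w /eqP []; rewrite tuple0.
rewrite (sum_tuple_cons (fun w => expR (birkhoff_sum (fun x => ln (G x)) (size w) (pad w)))).
rewrite -[RHS]IH exchange_big/=; apply: eq_bigr => w _.
under eq_bigr do rewrite birkhoff_sum_cons expRD /= lnK ?posrE//.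
by rewrite -mulr_suml G1 mul1r.
Qed.

End strings.

Section empirical_invariance.
Variables (N : nat) (R : realType).

(** The two sides differ by a telescoping sum. *)
Lemma empirical_almost_invariant n (x : symb N) v : (0 < n)%N ->
  `|\sum_a cylm (empirical_prob R n x) (a :: v) - cylm (empirical_prob R n x) v|
    <= n%:R^-1.
Proof.
move=> n0; under eq_bigr do rewrite cylm_empirical//.
rewrite -mulr_sumr exchange_big/= cylm_empirical// -mulrBr.
pose I k : R := (iter k (@left_shift N) x \in cylinder v)%:R.
rewrite (eq_bigr (fun k : 'I_n => I k.+1)); last first.
  move=> k _; rewrite /I iterS; set y := iter k _ x.
  rewrite (bigD1 (y 0%N))//= big1 ?addr0.
    congr (nat_of_bool _)%:R; apply/idP/idP => /set_mem h; apply/mem_set.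
      by move=> j jv; exact: (h j.+1).
    by move=> [|j] //= jv; exact: h.
  move=> a ay; rewrite memNset// => /(_ 0%N isT)/= ya.
  by move: ay; rewrite ya eqxx.
rewrite -sumrB -(big_mkord xpredT (fun k => I k.+1 - I k)) telescope_sumr//.
rewrite normrM ger0_norm// ler_piMr// /I.
by case: (_ \in _); case: (_ \in _); rewrite ?subrr ?subr0 ?sub0r ?normrN ?normr0 ?normr1.
Qed.

End empirical_invariance.

(** A bounded function converges along any ultrafilter, which replaces the
    extraction of subsequences. *)
Lemma ultra_cvg01 (R : realType) (T : Type) (G : set_system T) (f : T -> R) :
  UltraFilter G -> (forall x, 0 <= f x <= 1) -> exists l : R, f @ G --> l.
Proof.
move=> GU f01.
have Gf : G (f @^-1` `[0, 1]) by apply: filterE => x; rewrite /= in_itv/= f01.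
have [c [_ fc]] := @segment_compact R 0 1 (f @ G) _ Gf.
exists c => V cV.
have [//|nV] := in_ultra_setVsetC (f @^-1` V) GU.
by have [y [nVy Vy]] := fc (~` V) V nV cV.
Qed.

(** * Limits of empirical measures *)

Definition pad_empirical N (R : realType) (w : string N) : prob_symb N R :=
  empirical_prob R (size w) (pad w).

Section limit_measure.
Variables (N : nat) (R : realType) (G : set_system (string N)).
Hypothesis GU : UltraFilter G.
Hypothesis Ginf : forall n, G [set w | (n <= size w)%N].

(** The limits of the masses of cylinders are consistent because those of each
    empirical measure are, and invariant because long words are almost
    invariant. *)
Lemma ultra_limit_measure : exists mu : prob_symb N R, shift_invariant mu /\
  forall v, cylm (pad_empirical R w) v @[w --> G] --> cylm mu v.
Proof.
have GF : ProperFilter G := ultra_proper.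
have /choice [p pP] : forall v, exists l : R,
    (fun w => cylm (pad_empirical R w) v) @ G --> l.
  by move=> v; apply: ultra_cvg01 => w; rewrite cylm_ge0 cylm_le1.
have p_sum (I : finType) (f : I -> string N) :
    (fun w => \sum_i cylm (pad_empirical R w) (f i)) @ G --> \sum_i p (f i).
  by apply: cvg_big => [|i _]; [exact: add_continuous|exact: pP].
have p0 v : 0 <= p v.
  apply: (closed_cvg [set x : R | 0 <= x]) (pP v); first exact: closed_ge.
  by apply: filterE => w; exact: cylm_ge0.
have p1 : p [::] = 1.
  apply: (cvg_unique (@Rhausdorff R)) (pP [::]) _.
  rewrite (_ : (fun w => _) = cst 1); first exact: cvg_cst.
  by apply/funext => w; rewrite cylm_nil.
have pr v : \sum_a p (rcons v a) = p v.
  apply: (cvg_unique (@Rhausdorff R)) (p_sum _ (rcons v)) _.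
  rewrite (_ : (fun w => _) = (fun w => cylm (pad_empirical R w) v)); first exact: pP.
  by apply/funext => w; rewrite cylm_rcons.
have pc v : \sum_a p (a :: v) = p v.
  apply/eqP; rewrite -subr_eq0 -normr_le0; apply/ler_addgt0Pr => e e0.
  rewrite add0r.
  have : (fun w => `|\sum_a cylm (pad_empirical R w) (a :: v) -
      cylm (pad_empirical R w) v|) @ G --> `|\sum_a p (a :: v) - p v|.
    by apply: cvg_norm; apply: cvgB; [exact: (p_sum _ (fun a => a :: v))|exact: pP].
  apply: (closed_cvg [set x : R | x <= e]); first exact: closed_le.
  apply: filterS (Ginf (Num.trunc e^-1).+1) => w /= wn.
  have w0 : (0 < size w)%N by exact: leq_trans wn.
  rewrite (le_trans (empirical_almost_invariant _ _ _ w0))//.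
  rewrite -[e]invrK lef_pV2 ?posrE ?invr_gt0 ?ltr0n//.
  rewrite (le_trans (ltW (truncnS_gt _)))// ler_nat//.
have [mu mup] := cylm_extension p0 p1 pr.
exists mu; split; last by move=> v; rewrite mup; exact: pP.
by apply: shift_invariant_cylm => v; rewrite mup; under eq_bigr do rewrite mup.
Qed.

End limit_measure.

Section local_functions.
Variables (N : nat) (R : realType).

Lemma continuous_agree (f : symb N -> R) n :
  (forall x y, agree n x y -> f x = f y) -> continuous f.
Proof.
move=> fn x A /= /nbhs_singleton Ax; apply/nbhs_symbP; exists n => y /= xy.
by rewrite /= -(fn x)//; exact/cylinder_mkseq.
Qed.

End local_functions.

Section block_g_function.
Variables (N : nat) (R : realType) (mu : prob_symb N R).
Hypothesis imu : shift_invariant mu.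

(** The probability under [mu] of the first letter given the next [q] ones,
    smoothed by [e] so as to be positive and to make sense on cylinders of
    mass zero. *)
Definition block_g q (e : R) (x : symb N) : R :=
  (cylm mu (mkseq x q.+1) + e / N.+1%:R) / (cylm mu (mkseq (left_shift x) q) + e).

Variables (q : nat) (e : R).
Hypothesis e_gt0 : 0 < e.

Lemma block_g_gt0 x : 0 < block_g q e x.
Proof.
by rewrite divr_gt0// ltr_wpDl ?cylm_ge0// divr_gt0.
Qed.

Lemma mkseqS_cons (x : symb N) n : mkseq x n.+1 = x 0%N :: mkseq (left_shift x) n.
Proof.
by rewrite /mkseq/= -[X in iota X _]/(1 + 0)%N iotaDl -map_comp.
Qed.

Lemma block_g_sum w : \sum_a block_g q e (pad (a :: w)) = 1.
Proof.
rewrite /block_g; under eq_bigr do rewrite mkseqS_cons shift_pad_cons.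
rewrite -mulr_suml big_split/= sumr_const card_ord cylm_cons//.
by rewrite -[X in _ + X]mulr_natr divfK// divff// gt_eqF// ltr_wpDl ?cylm_ge0.
Qed.

Lemma block_g_agree x y : agree q.+1 x y -> block_g q e x = block_g q e y.
Proof.
move=> xy; rewrite /block_g !mkseqS_cons (xy 0%N)//.
by rewrite (_ : mkseq (left_shift x) q = mkseq (left_shift y) q)//;
  apply/eq_in_map => k; rewrite mem_iota => /andP[_ kq]; exact: xy.
Qed.

Lemma continuous_ln_block_g : continuous (fun x => - ln (block_g q e x)).
Proof.
by apply: (@continuous_agree _ _ _ q.+1) => x y /block_g_agree ->.
Qed.

(** Without the smoothing, the integral would be the conditional entropy
    [block_entropy mu q.+1 - block_entropy mu q] of the first letter given the
    next [q] ones. *)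
Lemma Rintegral_ln_block_g : \int[mu]_x (- ln (block_g q e x)) <=
  block_entropy mu q.+1 +
  \sum_(v : q.-tuple 'I_N.+1) cylm mu v * ln (cylm mu v + e).
Proof.
rewrite (@Rintegral_agree _ _ _ _ q.+1); last 2 first.
- by apply: measurable_continuous_symb; exact: continuous_ln_block_g.
- by move=> x y /block_g_agree ->.
rewrite /block_entropy.
rewrite (sum_tuple_cons (fun w => - ln (block_g q e (pad w)) * cylm mu w)).
rewrite (sum_tuple_cons (fun w => - (cylm mu w * ln (cylm mu w)))).
have -> : \sum_(v : q.-tuple 'I_N.+1) cylm mu v * ln (cylm mu v + e) =
    \sum_a \sum_(v : q.-tuple 'I_N.+1) cylm mu (a :: v) * ln (cylm mu v + e).
  rewrite exchange_big/=; apply: eq_bigr => v _.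
  by rewrite -mulr_suml cylm_cons.
rewrite -big_split/=; apply: ler_sum => a _.
rewrite -big_split/=; apply: ler_sum => v _.
rewrite /block_g mkseqS_cons shift_pad_cons -[X in mkseq _ X](size_tuple v) mkseq_pad.
rewrite -[pad (a :: v) 0%N]/a.
have eN : 0 < e / N.+1%:R by rewrite divr_gt0.
rewrite ln_div ?posrE; last 2 first.
- by rewrite ltr_wpDl ?cylm_ge0.
- by rewrite ltr_wpDl ?cylm_ge0.
rewrite opprB mulrBl mulrC [X in _ - X]mulrC addrC lerD2l lerN2.
have [->|av] := eqVneq (cylm mu (a :: v)) 0; first by rewrite !mul0r.
have {}av : 0 < cylm mu (a :: v) by rewrite lt_neqAle eq_sym av cylm_ge0.
by rewrite ler_wpM2l ?cylm_ge0// ler_ln ?posrE ?addr_gt0// lerDl ltW.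
Qed.

End block_g_function.

Lemma block_entropy_smoothing N (R : realType) (mu : prob_symb N R) q :
  (fun e => \sum_(v : q.-tuple 'I_N.+1) cylm mu v * ln (cylm mu v + e)) @ 0^'+ -->
  - block_entropy mu q.
Proof.
rewrite /block_entropy -sumrN; apply: cvg_big => [|v _]; first exact: add_continuous.
rewrite opprK; have [->|v0] := eqVneq (cylm mu v) 0.
  rewrite mul0r (_ : (fun e => _) = cst 0); first exact: cvg_cst.
  by apply/funext => e; rewrite mul0r.
have {}v0 : 0 < cylm mu v by rewrite lt_neqAle eq_sym v0 cylm_ge0.
apply: cvgMr; rewrite -{2}[cylm mu v]addr0.
apply: (cvg_comp (fun e => cylm mu v + e) (@ln R)).
  apply: cvg_at_right_filter; apply: cvgD; [exact: cvg_cst|exact: cvg_id].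
by apply: continuous_ln; rewrite addr0.
Qed.

(** * Upper bound for the abscissa *)

Section contraction_ratios.
Variables (N : nat) (R : realType) (Lam : symb N -> R) (cmin cmax : R).
Hypotheses (cmax_lt0 : cmax < 0) (LamP : forall x, cmin <= Lam x <= cmax).
Implicit Types (w : string N) (x y : symb N).

Lemma birkhoff_sum_le n x : birkhoff_sum Lam n x <= n%:R * cmax.
Proof.
rewrite /birkhoff_sum mulrC mulr_natr -[X in _ *+ X]card_ord -sumr_const.
by apply: ler_sum => k _; have /andP[] := LamP (iter k (@left_shift N) x).
Qed.

Lemma birkhoff_sumS n x :
  birkhoff_sum Lam n.+1 x = birkhoff_sum Lam n x + Lam (iter n (@left_shift N) x).
Proof. by rewrite /birkhoff_sum big_ord_recr. Qed.

Lemma s_ge w x : cylinder w x -> expR (birkhoff_sum Lam (size w) x) <= s_ Lam w.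
Proof.
move=> xw; apply: ub_le_sup; last by exists x.
exists 1 => _ [y _ <-]; rewrite -expR0 ler_expR (le_trans (birkhoff_sum_le _ _))//.
by rewrite mulr_ge0_le0// ltW.
Qed.

Lemma s_le w (b : R) :
  (forall x, cylinder w x -> expR (birkhoff_sum Lam (size w) x) <= b) -> s_ Lam w <= b.
Proof.
move=> h; apply: ge_sup; first by exists (expR (birkhoff_sum Lam (size w) (pad w))), (pad w).
by move=> _ [x xw <-]; exact: h.
Qed.

Lemma s_gt0 w : 0 < s_ Lam w.
Proof. exact: lt_le_trans (expR_gt0 _) (s_ge (@cylinder_pad N w)). Qed.

Lemma cylinder_rcons w a x : cylinder (rcons w a) x -> cylinder w x.
Proof.
by move=> xw k kw; have := xw k; rewrite size_rcons nth_rcons kw ltnW// => ->.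
Qed.

(** Together with [s_rcons_ge], each additional letter multiplies [s_] by a
    factor bounded away from 0 and from 1. *)
Lemma s_rcons_le w a : s_ Lam (rcons w a) <= expR cmax * s_ Lam w.
Proof.
apply: s_le => x xw; rewrite size_rcons birkhoff_sumS expRD mulrC.
rewrite ler_pM ?expR_ge0// ?ler_expR; last exact/s_ge/cylinder_rcons/xw.
by have /andP[] := LamP (iter (size w) (@left_shift N) x).
Qed.

Variable c : R.
Hypotheses (c_ge1 : 1 <= c) (LamC3 : forall (n : nat) x y, (0 < n)%N ->
    (forall k, (k < n)%N -> x k = y k) ->
    c^-1 <= expR (birkhoff_sum Lam n x) / expR (birkhoff_sum Lam n y) <= c).

Lemma s_le_cylinder w x : cylinder w x ->
  s_ Lam w <= c * expR (birkhoff_sum Lam (size w) x).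
Proof.
move=> xw; apply: s_le => y yw; have [w0|w0] := posnP (size w).
  by rewrite w0 /birkhoff_sum !big_ord0 expR0 mulr1.
have /andP[_] := @LamC3 (size w) y x w0 (fun k kw => etrans (yw k kw) (esym (xw k kw))).
by rewrite ler_pdivrMr ?expR_gt0.
Qed.

Lemma s_rcons_ge w a : expR cmin / c * s_ Lam w <= s_ Lam (rcons w a).
Proof.
have c0 : 0 < c by exact: lt_le_trans c_ge1.
set x := pad (rcons w a); have xw : cylinder (rcons w a) x by exact: cylinder_pad.
apply: le_trans (s_ge xw); rewrite size_rcons birkhoff_sumS expRD [leRHS]mulrC.
have := s_le_cylinder (cylinder_rcons xw); rewrite -ler_pdivrMl// => h.
rewrite -mulrA; apply: ler_pM => //.
- by rewrite mulr_ge0 ?invr_ge0 ?(ltW c0)// ltW// s_gt0.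
- by rewrite ler_expR; have /andP[] := LamP (iter (size w) (@left_shift N) x).
Qed.

Lemma s_powR_le t w x : cylinder w x ->
  s_ Lam w `^ t <= c `^ `|t| * expR (t * birkhoff_sum Lam (size w) x).
Proof.
move=> xw; have c0 : 0 < c by exact: lt_le_trans c_ge1.
have s0 := s_gt0 w.
rewrite /powR !gt_eqF// -expRD ler_expR.
have lnl : birkhoff_sum Lam (size w) x <= ln (s_ Lam w).
  by rewrite -[leLHS]expRK ler_ln ?posrE ?expR_gt0//; exact: s_ge.
have lnu : ln (s_ Lam w) <= ln c + birkhoff_sum Lam (size w) x.
  rewrite -[X in _ <= _ + X]expRK -lnM ?posrE ?expR_gt0// ler_ln ?posrE//.
    exact: s_le_cylinder.
  by rewrite mulr_gt0 ?expR_gt0.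
have lnc : 0 <= ln c by rewrite ln_ge0.
move: (ln _) (ln c) (birkhoff_sum _ _ _) lnl lnu lnc => s l b sb sl l0.
have [t0|t0] := ger0P t; nra.
Qed.

End contraction_ratios.

Section upper_bound.
Variables (N M : nat) (R : realType) (U : prob_symb N R -> 'rV[R]_M)
  (Lam : symb N -> R) (C : set 'rV[R]_M).
Hypotheses (U_cont : continuous U) (Lam_cont : continuous Lam) (C_closed : closed C).
Variables (cmin cmax : R).
Hypotheses (cmax_lt0 : cmax < 0) (LamP : forall x, cmin <= Lam x <= cmax).
Variable c : R.
Hypotheses (c_ge1 : 1 <= c) (LamC3 : forall (n : nat) (x y : symb N), (0 < n)%N ->
    (forall k, (k < n)%N -> x k = y k) ->
    c^-1 <= expR (birkhoff_sum Lam n x) / expR (birkhoff_sum Lam n y) <= c).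

Let h (mu : prob_symb N R) := partition_entropy mu (@left_shift N) (@cylinder_partition N).

(** The increments of the block entropies have mean value the entropy, so that
    one of them is as small as the entropy allows. *)
Lemma block_entropy_increment mu t : shift_invariant mu ->
  h mu + t * \int[mu]_x Lam x < 0 ->
  exists q, block_entropy mu q.+1 - block_entropy mu q + t * \int[mu]_x Lam x < 0.
Proof.
move=> imu; set l := \int[mu]_x Lam x => hl.
apply: contrapT => /forallNP nq.
have step n : - (n%:R * (t * l)) <= block_entropy mu n.
  elim: n => [|n IH]; first by rewrite mul0r oppr0 block_entropy_ge0.
  have /negP := nq n; rewrite -leNgt => ge0.
  rewrite -natr1 mulrDl mul1r opprD; lra.
have : - (t * l) <= h mu.
  apply: ler_cvg_to (cvg_cst _) (block_entropy_is_cvg imu) _.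
  near=> n; have n0 : 0 < n%:R :> R by rewrite ltr0n; near: n; exact: nbhs_infty_gt.
  by rewrite ler_pdivlMr// mulNr mulrC.
by move: hl; rewrite -ltrBrDr sub0r => /lt_le_trans hl /hl; rewrite ltxx.
Unshelve. all: by end_near. Qed.

Lemma block_g_integral_lt0 mu t : shift_invariant mu ->
  h mu + t * \int[mu]_x Lam x < 0 ->
  exists q e, 0 < e /\
    \int[mu]_x (- ln (block_g mu q e x)) + t * \int[mu]_x Lam x < 0.
Proof.
move=> imu /(block_entropy_increment imu) [q]; set l := \int[mu]_x Lam x => ql.
have := @block_entropy_smoothing N R mu q.
pose d := - (block_entropy mu q.+1 - block_entropy mu q + t * l).
have d0 : 0 < d by rewrite oppr_gt0.
move=> /cvgrPdist_lt /(_ _ d0) hd.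
have [e [/= ed e0]] := filter_ex (filterI hd (nbhs_right_gt (0 : R))).
exists q, e; split => //.
have := Rintegral_ln_block_g imu q e0.
move: ed; rewrite ltr_norml => /andP[ed _]; move: ed.
rewrite /d; lra.
Qed.

(** If the series diverges, the sets of strings off which it converges form a
    proper filter. An ultrafilter finer than it contains no set of strings on
    which the series converges. Let [mu] be the limit of the empirical
    measures along it. The hypothesis on [mu] provides a g-function for which
    the terms of the series are, on a set of this ultrafilter, dominated by
    [sum_g_function] times a geometric sequence: a contradiction. *)
Lemma zeta_summable t :
  (forall mu, shift_invariant mu -> C (U mu) -> h mu + t * \int[mu]_x Lam x < 0) ->
  summable (zeta_strings U C) (fun w => (s_ Lam w `^ t)%:E).
Proof.
move=> htC; apply: contrapT => nsum.
pose E := zeta_strings U C; pose a (w : string N) := s_ Lam w `^ t.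
have a0 w : 0 <= a w by exact: powR_ge0.
pose F : set_system (string N) := [set D | summable (E `\` D) (EFin \o a)].
have FF : ProperFilter F.
  split; first by rewrite /F /= setD0.
  split.
  - by rewrite /F /= setDT; apply: finite_set_summable.
  - by move=> A B FA FB; rewrite /F /= setDIr; exact: summable_setU.
  - by move=> A B AB; apply: sub_summable => // w [Ew nB]; split => // /AB.
have [G [GU FG]] := ultraFilterLemma FF.
have GE : G E by apply: FG; rewrite /F /= setDv; exact: finite_set_summable.
have Ginf n : G [set w | (n <= size w)%N].
  apply: FG; rewrite /F /=; apply: finite_set_summable => //.
  apply: (@sub_finite_set _ _ (\bigcup_(k < n) (@tval k 'I_N.+1 @` setT))).
    move=> w [_ /negP]; rewrite -ltnNge => wn; exists (size w) => //.
    by exists (in_tuple w).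
  apply: bigcup_finite; first exact: finite_II.
  by move=> k _; apply: finite_image; exact: finite_finset.
have [mu [imu Gmu]] := ultra_limit_measure R GU Ginf.
have cvgmu : @pad_empirical N R @ G --> mu.
  by apply: cvg_weak => v; exact: Gmu.
have CU : C (U mu).
  have UG : (fun w => U (pad_empirical R w)) @ G --> U mu.
    exact: cvg_comp cvgmu (@U_cont mu).
  apply: (closed_cvg C C_closed) UG.
  by apply: filterS GE => w [_ wC]; apply: wC; exists (pad w).
(* The integral d of [lg + t Lam] is negative. By convergence along G, the
   corresponding averages over the words of a set D of G are at most [d / 2],
   and this is the exponential gain that makes the series converge on D. *)
have [q [e [e0 neg]]] := block_g_integral_lt0 imu (htC _ imu CU).
set lg := fun x => - ln (block_g mu q e x) in neg.
have clg : continuous lg by exact: continuous_ln_block_g.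
set d := \int[mu]_x lg x + t * \int[mu]_x Lam x in neg.
have cvgd : (fun w => \int[pad_empirical R w]_x lg x +
    t * \int[pad_empirical R w]_x Lam x) @ G --> d.
  apply: cvgD; first exact: (@cvg_Rintegral_cylm _ _ (@pad_empirical N R @ G) mu lg _ Gmu (@clg)).
  apply: cvgMr.
  exact: (@cvg_Rintegral_cylm _ _ (@pad_empirical N R @ G) mu Lam _ Gmu (@Lam_cont)).
pose D := [set w : string N | (0 < size w)%N /\
  birkhoff_sum lg (size w) (pad w) + t * birkhoff_sum Lam (size w) (pad w)
    <= (d / 2) * (size w)%:R].
have GD : G D.
  have d20 : 0 < - d / 2 by rewrite divr_gt0// oppr_gt0.
  have /cvgrPdist_le /(_ _ d20) := cvgd.
  move=> Gd; apply: filterS (filterI (Ginf 1%N) Gd) => w [/= w0].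
  rewrite /pad_empirical !Rintegral_empirical// => dw; split => //.
  have w0R : 0 < (size w)%:R :> R by rewrite ltr0n.
  rewrite -ler_pdivrMr// mulrDl mulrC -[X in _ + X]mulrA [X in _ + _ * X]mulrC.
  move: dw; rewrite ler_norml; lra.
have : summable (E `\` ~` D) (EFin \o a).
  apply: (@summable_strings _ _ a (fun w => c `^ `|t| * expR (d / 2 * (size w)%:R) *
      expR (birkhoff_sum (fun x => ln (block_g mu q e x)) (size w) (pad w)))
      _ (c `^ `|t|) (expR (d / 2))) => //.
  - by move=> w; rewrite !mulr_ge0 ?powR_ge0 ?expR_ge0.
  - move=> w [_ /contrapT [w0 wD]].
    have := s_powR_le cmax_lt0 LamP c_ge1 LamC3 t (@cylinder_pad N w).
    move=> /le_trans; apply; rewrite -mulrA ler_wpM2l ?powR_ge0// -expRD ler_expR.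
    have -> : birkhoff_sum (fun x => ln (block_g mu q e x)) (size w) (pad w) =
        - birkhoff_sum lg (size w) (pad w).
      by rewrite /birkhoff_sum sumrN opprK.
    by rewrite lerBrDr addrC.
  - exact: powR_ge0.
  - by rewrite expR_gt0 expR_lt1 ltr_pdivrMr// mul0r.
  - move=> n; rewrite (eq_bigr (fun w : n.-tuple 'I_N.+1 =>
        c `^ `|t| * expR (d / 2) ^+ n *
        expR (birkhoff_sum (fun x => ln (block_g mu q e x)) (size w) (pad w)))).
      rewrite -mulr_sumr sum_g_function ?mulr1//.
      + by move=> x; exact: block_g_gt0.
      + by move=> w; exact: block_g_sum.
    by move=> w _; rewrite size_tuple expRM_natr.
(* The series converges on D, so the complement of D belongs to F, hence to
   G. *)
move=> /FG GnD; have GP : ProperFilter G := @ultra_proper _ _ GU.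
apply: (@filter_not_empty _ G GP); rewrite -(setICr D).
exact: filterI GD GnD.
Qed.

End upper_bound.

(** * Typical sequences of independent blocks *)

Section typical_sequences.
Variables (R : realType) (B : finType) (p : B -> R).
Hypotheses (p_ge0 : forall b, 0 <= p b) (p_sum : \sum_b p b = 1).

Let weight (s : seq B) := \prod_(b <- s) p b.
Let mean (f : B -> R) := \sum_b p b * f b.

Lemma weight_sum m : \sum_(s : m.-tuple B) weight s = 1.
Proof.
elim: m => [|m IH].
  rewrite (bigD1 [tuple])//= big1 ?addr0; first by rewrite /weight big_nil.
  by move=> w /eqP []; rewrite tuple0.
rewrite sum_tuple_cons; under eq_bigr do under eq_bigr do rewrite /weight big_cons.
by under eq_bigr do rewrite -mulr_sumr IH mulr1.
Qed.

(** The variance of a sum of independent variables, here by induction on the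
    number of variables. *)
Lemma variance_sum (f : B -> R) m : mean f = 0 ->
  \sum_(s : m.-tuple B) weight s * (\sum_(b <- s) f b) ^+ 2 =
  m%:R * mean (fun b => f b ^+ 2).
Proof.
move=> f0; elim: m => [|m IH].
  rewrite mul0r big1// => s _; rewrite tuple0 big_nil expr0n mulr0//.
rewrite (sum_tuple_cons (fun s => weight s * (\sum_(b <- s) f b) ^+ 2)).
pose F (s : seq B) := \sum_(b <- s) f b.
rewrite (eq_bigr (fun b => p b * f b ^+ 2 + p b * f b *
    (2 * \sum_(s : m.-tuple B) weight s * F s) +
    p b * \sum_(s : m.-tuple B) weight s * F s ^+ 2)).
  rewrite !big_split/= -!mulr_suml p_sum mul1r -/(mean f) f0 mul0r addr0 IH.
  by rewrite -natr1 mulrDl mul1r addrC.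
move=> b _; rewrite !mulr_sumr.
rewrite [X in X + _ + _](_ : _ = \sum_(s : m.-tuple B) p b * f b ^+ 2 * weight s).
  2: by rewrite -mulr_sumr weight_sum mulr1.
rewrite -!big_split/=; apply: eq_bigr => s _.
rewrite /weight big_cons -/(weight s) big_cons -/(F s); ring.
Qed.

Lemma chebyshev_sum (f : B -> R) m : (0 < m)%N ->
  \sum_(s : m.-tuple B | m%:R < `|\sum_(b <- s) f b - m%:R * mean f|) weight s
  <= mean (fun b => (f b - mean f) ^+ 2) / m%:R.
Proof.
move=> m0; have m0R : 0 < m%:R :> R by rewrite ltr0n.
have mean0 : mean (fun b => f b - mean f) = 0.
  rewrite {1}/mean; under eq_bigr do rewrite mulrBr.
  by rewrite sumrB -mulr_suml p_sum mul1r subrr.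
have := variance_sum m mean0 => var.
rewrite ler_pdivlMr// -(ler_pM2l m0R) -var mulrCA -expr2.
rewrite mulr_suml big_mkcond/=; apply: ler_sum => s _.
have w0 : 0 <= weight s by exact: prodr_ge0.
case: ifPn => [h|_]; last by rewrite mulr_ge0// sqr_ge0.
have -> : \sum_(b <- s) (f b - mean f) = \sum_(b <- s) f b - m%:R * mean f.
  by rewrite sumrB big_const_seq count_predT size_tuple iter_addr_0 mulr_natl.
rewrite ler_wpM2l// -[leRHS]real_normK ?num_real// ler_sqr ?nnegrE//.
exact: ltW.
Qed.

(** Chebyshev's inequality for finitely many functions at once. The deviation
    allowed is 1 per entry, which is enough because the entries will be long
    blocks. *)
Lemma typical_sequences (J : finType) (f : J -> B -> R) :
  exists m0, forall m, (m0 <= m)%N -> 2^-1 <=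
  \sum_(s : m.-tuple B | [forall j, `|\sum_(b <- s) f j b - m%:R * mean (f j)| <= m%:R])
    weight s.
Proof.
pose V := \sum_j mean (fun b => (f j b - mean (f j)) ^+ 2).
have V0 : 0 <= V.
  by apply: sumr_ge0 => j _; apply: sumr_ge0 => b _; rewrite mulr_ge0 ?sqr_ge0.
exists (Num.trunc (V * 2)).+1 => m mV.
have m0 : (0 < m)%N by exact: leq_trans mV.
have m0R : 0 < m%:R :> R by rewrite ltr0n.
have w0 (s : seq B) : 0 <= weight s by exact: prodr_ge0.
have Vm : V / m%:R <= 2^-1.
  rewrite ler_pdivrMr// mulrC ler_pdivlMr// (le_trans (ltW (truncnS_gt _)))//.
  by rewrite ler_nat.
rewrite -(lerD2r (V / m%:R)); apply: (@le_trans _ _ 1).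
  by rewrite [leRHS](splitr 1) div1r lerD2l.
rewrite -[leLHS](weight_sum m) [leLHS](bigID (fun s : m.-tuple B => [forall j, `|\sum_(b <- s) f j b - m%:R * mean (f j)| <= m%:R]))/=.
rewrite lerD2l /V mulr_suml.
apply: (@le_trans _ _ (\sum_j \sum_(s : m.-tuple B |
    m%:R < `|\sum_(b <- s) f j b - m%:R * mean (f j)|) weight s)); last first.
  by apply: ler_sum => j _; exact: chebyshev_sum.
under [leRHS]eq_bigr do rewrite big_mkcond/=.
rewrite exchange_big/= big_mkcond/=; apply: ler_sum => s _.
case: ifPn => [|_]; last by apply: sumr_ge0 => j _; case: ifP.
rewrite negb_forall => /existsP[j]; rewrite -ltNge => hj.
by rewrite (bigD1 j)//= hj lerDl sumr_ge0// => k _; case: ifP.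
Qed.

(** The function [- ln p] is among those controlled, so a typical sequence has
    weight at most [expR (- m (H - 1))], and the typical sequences have total
    weight at least 1/2. *)
Lemma typical_sequences_card (J : finType) (f : J -> B -> R) :
  exists m0, forall m, (m0 <= m)%N -> exists T : {set m.-tuple B},
    2^-1 * expR (m%:R * (\sum_b - (p b * ln (p b)) - 1)) <= #|T|%:R /\
    forall s j, s \in T -> `|\sum_(b <- s) f j b - m%:R * mean (f j)| <= m%:R.
Proof.
pose H := \sum_b - (p b * ln (p b)).
pose g (j : option J) := if j is Some j then f j else fun b => - ln (p b).
have [m0 hm] := typical_sequences g; exists m0 => m /hm {}hm.
pose T := [set s : m.-tuple B | [forall j, `|\sum_(b <- s) g j b - m%:R * mean (g j)| <= m%:R]]%SET.
exists T.
split; last by move=> s j; rewrite inE => /forallP /(_ (Some j)).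
rewrite -ler_pdivlMr ?expR_gt0// (le_trans hm)// -expRN -/H.
rewrite (eq_bigl (fun s => s \in T)); last by move=> s; rewrite inE.
rewrite [leRHS]mulr_natl -sumr_const.
apply: ler_sum => s; rewrite inE => /forallP /(_ None) /= hs.
have [s0|/allPn[b bs]] := boolP (all (fun b => 0 < p b) s); last first.
  rewrite -leNgt => pb; have {}pb : p b = 0 by apply/eqP; rewrite eq_le pb p_ge0.
  by rewrite /weight (big_rem b)//= pb mul0r expR_ge0.
have -> : weight s = expR (- \sum_(b <- s) - ln (p b)).
  rewrite sumrN opprK expR_sum /weight big_seq_cond [RHS]big_seq_cond.
  by apply: eq_bigr => b /andP[/(allP s0) b0 _]; rewrite lnK.
rewrite ler_expR lerN2 mulrBr mulr1.
have -> : H = mean (fun b => - ln (p b)) by apply: eq_bigr => b _; rewrite mulrN.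
move: hs; rewrite ler_norml => /andP[h _]; lra.
Qed.

End typical_sequences.

(** * Words with prescribed statistics *)

(** Its Birkhoff sums count the occurrences of the word [v]. *)
Definition visit N (R : realType) (v : string N) (x : symb N) : R :=
  (x \in cylinder v)%:R.

Section block_words.
Variables (N : nat) (R : realType).
Implicit Types (v w : string N) (x y : symb N).

Lemma birkhoff_sumD (f : symb N -> R) m n x : birkhoff_sum f (m + n) x =
  birkhoff_sum f m x + birkhoff_sum f n (iter m (@left_shift N) x).
Proof.
rewrite /birkhoff_sum big_split_ord/=; congr (_ + _).
by apply: eq_bigr => k _; rewrite addnC iterD.
Qed.

Lemma birkhoff_visit_bounds n x v : 0 <= birkhoff_sum (visit R v) n x <= n%:R.
Proof.
rewrite sumr_ge0//= -[n in n%:R]card_ord -sumr_const; apply: ler_sum => k _.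
by rewrite /visit; case: (_ \in _); rewrite ?ler01.
Qed.

Lemma cylinder_cat v w x :
  cylinder (v ++ w) x <-> cylinder v x /\ cylinder w (iter (size v) (@left_shift N) x).
Proof.
rewrite iter_shift; split=> [xvw|[xv xw] k].
  split=> k kv.
    by have := xvw k; rewrite nth_cat kv size_cat ltn_addr// => ->.
  have := xvw (k + size v)%N.
  rewrite nth_cat (_ : (k + size v < size v)%N = false) ?addnK; last by lia.
  by apply; rewrite size_cat; lia.
rewrite size_cat nth_cat; case: (ltnP k (size v)) => [kv _|vk kvw]; first exact: xv.
by rewrite -xw ?subnK// ltn_subLR.
Qed.

Lemma visit_agree q i v x y : agree q x y -> (i + size v <= q)%N ->
  visit R v (iter i (@left_shift N) x) = visit R v (iter i (@left_shift N) y).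
Proof.
move=> xy iq; rewrite /visit !iter_shift; congr (nat_of_bool _)%:R.
have e k : (k < size v)%N -> x (k + i)%N = y (k + i)%N by move=> kv; apply: xy; lia.
by apply/idP/idP => /set_mem h; apply/mem_set => k kv; rewrite -h// e.
Qed.

Lemma sum_late_starts q l : (\sum_(i < q) (q < i + l) <= l)%N.
Proof.
suff h n : (\sum_(i < n) (q < i + l) <= n + l - q)%N by have := h q; lia.
elim: n => [|n IH]; first by rewrite big_ord0.
rewrite big_ord_recr/=; move: (\sum_(i < n) _)%N IH => S IH.
by case: (ltnP q (n + l)) => h /=; [rewrite addn1|rewrite addn0]; lia.
Qed.

(** An occurrence of [v] that starts among the first [q] letters but ends
    after them starts in one of the last [size v] positions. *)
Lemma late_starts_le q v (F : 'I_q -> R) :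
  (forall i, `|F i| <= 1) -> (forall i : 'I_q, (i + size v <= q)%N -> F i = 0) ->
  `|\sum_(i < q) F i| <= (size v)%:R.
Proof.
move=> F1 F0; rewrite (le_trans (ler_norm_sum _ _ _))//.
apply: (@le_trans _ _ (\sum_(i < q) (q < i + size v)%:R)).
  apply: ler_sum => i _; case: ltnP => [_|/F0 ->]; [exact: F1|by rewrite normr0].
by rewrite -natr_sum ler_nat sum_late_starts.
Qed.

Lemma birkhoff_visit_agree q v x y : agree q x y ->
  `|birkhoff_sum (visit R v) q x - birkhoff_sum (visit R v) q y| <= (size v)%:R.
Proof.
move=> xy; rewrite -sumrB; apply: late_starts_le => i.
  rewrite /visit; case: (_ \in _); case: (_ \in _);
    by rewrite ?subrr ?subr0 ?sub0r ?normrN ?normr0 ?normr1 ?ler01.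
by move=> iq; rewrite (visit_agree xy iq) subrr.
Qed.

(** Only the occurrences of [v] that straddle two consecutive blocks are
    missed when counting block by block. *)
Lemma birkhoff_visit_flatten q v (s : seq (q.-tuple 'I_N.+1)) x :
  cylinder (flatten (map val s)) x ->
  `|birkhoff_sum (visit R v) (size s * q) x -
    \sum_(b <- s) birkhoff_sum (visit R v) q (pad b)| <= (size s)%:R * (size v)%:R.
Proof.
elim: s x => [|b s IH] x.
  by move=> _; rewrite big_nil /birkhoff_sum big_ord0 subrr normr0 mul0r.
rewrite /= => /cylinder_cat[xb]; rewrite size_tuple => /IH {}IH.
rewrite mulSn birkhoff_sumD big_cons opprD addrACA (le_trans (ler_normD _ _))//.
rewrite -natr1 mulrDl mul1r [leRHS]addrC lerD//; apply: birkhoff_visit_agree => k kq.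
by rewrite xb// size_tuple.
Qed.

Variable mu : prob_symb N R.
Hypothesis imu : shift_invariant mu.

(** By invariance, the expected number of occurrences of [v] at each position
    is the mass of its cylinder, apart from the positions too close to the end
    of the block. *)
Lemma mean_birkhoff_visit q v :
  `|\sum_(b : q.-tuple 'I_N.+1) cylm mu b * birkhoff_sum (visit R v) q (pad b) -
    q%:R * cylm mu v| <= (size v)%:R.
Proof.
pose E (i : 'I_q) := \sum_(b : q.-tuple 'I_N.+1)
  cylm mu b * visit R v (iter i (@left_shift N) (pad b)).
have -> : \sum_(b : q.-tuple 'I_N.+1) cylm mu b * birkhoff_sum (visit R v) q (pad b) -
    q%:R * cylm mu v = \sum_(i < q) (E i - cylm mu v).
  rewrite sumrB; congr (_ - _); last by rewrite sumr_const card_ord mulr_natl.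
  by rewrite /E exchange_big/=; apply: eq_bigr => b _; rewrite mulr_sumr.
have E01 i : 0 <= E i <= 1.
  have v01 (x : symb N) : 0 <= visit R v x <= 1.
    by rewrite /visit; case: (_ \in _); rewrite ?ler01 ?lexx.
  rewrite sumr_ge0 => [|b _]; last by rewrite mulr_ge0 ?cylm_ge0//; have /andP[] := v01 (iter i (@left_shift N) (pad b)).
  rewrite -(cylm_sum mu q); apply: ler_sum => b _.
  by rewrite ler_piMr ?cylm_ge0//; have /andP[] := v01 (iter i (@left_shift N) (pad b)).
apply: late_starts_le => i.
  have /andP[E0 E1] := E01 i; have := cylm_ge0 mu v; have := cylm_le1 mu v.
  rewrite ler_norml; lra.
move=> iq; apply/eqP; rewrite subr_eq0; apply/eqP.
rewrite /cylm -(iter_invariant (@measurable_left_shift N) imu i (measurable_cylinder v)).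
rewrite -(fine_probability_sum mu (F := fun b : q.-tuple 'I_N.+1 =>
  if iter i (@left_shift N) (pad b) \in cylinder v then cylinder b else set0)
  (B := (iter i (@left_shift N)) @^-1` cylinder v)).
- apply: eq_bigr => b _; rewrite /visit; case: ifP => _; first by rewrite mulr1.
  by rewrite mulr0 measure0.
- by move=> b; case: ifP => // _; exact: measurable_cylinder.
- apply/trivIsetP => b b' _ _ bb'; case: ifP => _; rewrite ?set0I//.
  case: ifP => _; rewrite ?setI0//.
  by have /trivIsetP/(_ b b' I I bb') := @cylinder_tuple_trivIset N q.
- have h (b : q.-tuple 'I_N.+1) x : cylinder b x ->
      (iter i (@left_shift N) x \in cylinder v) =
      (iter i (@left_shift N) (pad b) \in cylinder v).
    move=> xb; have xpad : agree q x (pad b).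
      by move=> k kq; rewrite xb ?size_tuple.
    have := visit_agree xpad iq; rewrite /visit.
    by case: (_ \in _); case: (_ \in _) => // /eqP; rewrite ?oner_eq0// eq_sym oner_eq0.
  apply/seteqP; split => [x [b _]|x /= xv].
    by case: ifP => // + xb; rewrite -(h b x xb) => /set_mem.
  have [b _ xb] : (\bigcup_(b : q.-tuple 'I_N.+1) cylinder b) x.
    by rewrite cylinder_tuple_cover.
  by exists b => //; rewrite ifT// -(h b x xb) mem_set.
Qed.

(** The measure need not be ergodic, so its own typical sequences may have
    statistics different from [mu]. Independent concatenations of long blocks
    drawn from [mu] do have the right statistics, up to the boundaries of the
    blocks, and their entropy per letter is [block_entropy mu q / q], which is
    at least the entropy. *)
Lemma many_typical_words (vs : seq (string N)) (e eta : R) : 0 < e -> 0 < eta ->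
  exists2 q, (0 < q)%N & exists m0, forall m, (m0 <= m)%N ->
  exists T : {set m.-tuple (q.-tuple 'I_N.+1)},
    expR ((m * q)%:R * (partition_entropy mu (@left_shift N) (@cylinder_partition N) - eta))
      <= #|T|%:R /\
    forall s x v, s \in T -> cylinder (flatten (map val s)) x -> v \in vs ->
      `|birkhoff_sum (visit R v) (m * q) x - (m * q)%:R * cylm mu v| <= e * (m * q)%:R.
Proof.
move=> e0 eta0; set h := partition_entropy _ _ _.
pose l := \max_(v <- vs) size v.
have lP v : v \in vs -> (size v <= l)%N by move=> vvs; exact: leq_bigmax_seq.
(* With this q, the errors on the statistics, [2 l] per block for the
   boundaries and 1 for the typical deviation, are at most [e q], and the
   losses in the logarithm of the cardinal, 1 per block and [ln 2], at most
   [eta q] per block. *)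
pose q := (maxn (Num.trunc ((2 * l).+1%:R / e)) (Num.trunc (2 / eta))).+1.
have qR : 0 < q%:R :> R by rewrite ltr0n.
have qe : (2 * l).+1%:R <= e * q%:R.
  rewrite mulrC -ler_pdivrMr// (le_trans (ltW (truncnS_gt _)))// ler_nat ltnS.
  exact: leq_maxl.
have qeta : 2 <= eta * q%:R.
  rewrite mulrC -ler_pdivrMr// (le_trans (ltW (truncnS_gt _)))// ler_nat ltnS.
  exact: leq_maxr.
exists q => //.
have [m0 hm] := @typical_sequences_card R _ (fun b : q.-tuple 'I_N.+1 => cylm mu b)
  (fun b => cylm_ge0 mu b) (cylm_sum mu q)
  'I_(size vs) (fun j b => birkhoff_sum (visit R (nth [::] vs j)) q (pad b)).
exists (maxn m0 1) => m; rewrite geq_max => /andP[/hm [T [Tcard Ttyp]] m1].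
exists T; split.
  apply: le_trans Tcard; rewrite natrM.
  have -> : (2^-1 : R) = expR (- ln 2) by rewrite expRN lnK// posrE.
  rewrite -expRD ler_expR -/(block_entropy mu q).
  have hq : h * q%:R <= block_entropy mu q.
    by rewrite -ler_pdivlMr//; exact: partition_entropy_le_block.
  have ln2 : ln (2 : R) <= 1 by have := @le_ln1Dx R 1; apply; lra.
  have mR : 1 <= m%:R :> R by rewrite ler1n.
  nra.
move=> s x v sT xs /[dup] /lP vl /(nthP [::]) [j jvs jv].
have := Ttyp s (Ordinal jvs) sT; rewrite /= jv => t1.
have := birkhoff_visit_flatten v xs; rewrite size_tuple => t2.
have := mean_birkhoff_visit q v.
set e_ := \sum_b _ => t3.
have t3' : `|m%:R * e_ - (m * q)%:R * cylm mu v| <= m%:R * (size v)%:R.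
  by rewrite natrM -mulrA -mulrBr normrM ger0_norm// ler_wpM2l.
have lv : (size v)%:R <= l%:R :> R by rewrite ler_nat.
rewrite [(m * q)%:R in leRHS]natrM mulrCA.
apply: (@le_trans _ _ (m%:R * (2 * l).+1%:R)); last by rewrite ler_wpM2l.
rewrite [(2 * l).+1%:R](_ : _ = 2 * l%:R + 1 :> R); last by rewrite -natr1 natrM.
have mR : 0 <= m%:R :> R by [].
have mlv : m%:R * (size v)%:R <= m%:R * l%:R :> R by rewrite ler_wpM2l.
move: t1 t2 t3'; rewrite !ler_norml; set a := birkhoff_sum _ _ _; set b := \sum_(_ <- _) _.
rewrite -/e_; lra.
Qed.

End block_words.

(** * Neighbourhoods and stopping *)

Section cylinder_neighbourhoods.
Variables (N : nat) (R : realType) (mu : prob_symb N R).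

(** The neighbourhoods of [mu] for convergence on cylinders. Every weak
    neighbourhood contains one of them. *)
Definition cylinder_near : set_system (prob_symb N R) :=
  filter_from [set p : seq (string N) * R | 0 < p.2]
    (fun p => [set nu | forall v, v \in p.1 -> `|cylm nu v - cylm mu v| <= p.2]).

Lemma cylinder_near_filter : Filter cylinder_near.
Proof.
apply: filter_from_filter; first by exists ([::], 1); exact: ltr01.
move=> [vs e] [vs' e'] /= e0 e'0; exists (vs ++ vs', Num.min e e').
  by rewrite /= lt_min e0.
move=> nu /= h; split => v vv.
  have hv : v \in vs ++ vs' by rewrite mem_cat vv.
  by apply: le_trans (h v hv) _; rewrite ge_min lexx.
have hv : v \in vs ++ vs' by rewrite mem_cat vv orbT.
by apply: le_trans (h v hv) _; rewrite ge_min lexx orbT.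
Qed.

Lemma cylinder_near_cvg v : cylm nu v @[nu --> cylinder_near] --> cylm mu v.
Proof.
have FF := cylinder_near_filter.
apply/cvgrPdist_le => e e0; exists ([:: v], e) => // nu /= h.
by rewrite distrC h// mem_head.
Qed.

Lemma nbhs_cylinder_near (A : set (prob_symb N R)) :
  nbhs mu A -> cylinder_near A.
Proof.
have FF := cylinder_near_filter.
by move=> Amu; apply: (cvg_weak FF cylinder_near_cvg).
Qed.

Lemma Rintegral_cylinder_near (f : symb N -> R) (e : R) : continuous f -> 0 < e ->
  cylinder_near [set nu | `|\int[nu]_x f x - \int[mu]_x f x| <= e].
Proof.
have FF := cylinder_near_filter.
move=> cf e0; have /cvgrPdist_le /(_ _ e0) := cvg_Rintegral_cylm FF cylinder_near_cvg cf.
by apply: filterS => nu /=; rewrite distrC.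
Qed.

End cylinder_neighbourhoods.

Section euclidean_distance.
Variables (R : realType) (M : nat).
Implicit Types (x y : 'rV[R]_M) (C : set 'rV[R]_M).

Lemma row_entry_le_norm x j : `|x 0 j| <= `|x|.
Proof.
rewrite -[`|x|]/(mx_norm x) mx_normrE.
exact: (le_bigmax _ (fun ij : 'I_1 * 'I_M => `|x ij.1 ij.2|) (0, j)).
Qed.

Lemma eucl_dist_le x y (r : R) : 0 <= r -> `|x - y| <= r / M.+1%:R ->
  eucl_dist x y <= r.
Proof.
move=> r0 xyr; rewrite /eucl_dist -[leRHS]ger0_norm// -sqrtr_sqr ler_wsqrtr//.
have rM : 0 <= r / M.+1%:R by rewrite divr_ge0.
apply: (@le_trans _ _ (\sum_(j < M) (r / M.+1%:R) ^+ 2)).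
  apply: ler_sum => j _; rewrite -[leLHS]real_normK ?num_real// ler_sqr ?nnegrE//.
  by apply: le_trans xyr; have := row_entry_le_norm (x - y) j; rewrite !mxE.
rewrite sumr_const card_ord -[leLHS]mulr_natr expr_div_n mulrAC ler_pdivrMr ?exprn_gt0//.
rewrite ler_wpM2l ?sqr_ge0// -natrX ler_nat; lia.
Qed.

Lemma dist_to_le x y C : C y -> (dist_to x C <= (eucl_dist x y)%:E)%E.
Proof. by move=> Cy; apply: ereal_inf_lbound; exists y. Qed.

Lemma nbhs_thickening C x (r : R) : C x -> 0 < r -> nbhs x (thickening C r).
Proof.
move=> Cx r0; have rM : 0 < r / M.+1%:R by rewrite divr_gt0.
apply/nbhs_ballP; exists (r / M.+1%:R) => // y; rewrite -ball_normE /ball_ /= => xy.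
rewrite /thickening/=; apply: le_trans (dist_to_le y Cx) _.
by rewrite lee_fin eucl_dist_le ?(ltW r0)// distrC ltW.
Qed.

End euclidean_distance.

Section stopping.
Variables (N : nat) (R : realType) (Lam : symb N -> R) (cmin cmax : R).
Hypotheses (cmax_lt0 : cmax < 0) (LamP : forall x, cmin <= Lam x <= cmax).

Let prolong (w : string N) j : string N := w ++ nseq j ord0.

Let prolongS w j : prolong w j.+1 = rcons (prolong w j) ord0.
Proof.
by rewrite /prolong -cats1 -catA; congr (_ ++ _); elim: j => //= j ->.
Qed.

Lemma s_prolong_le (w : string N) j :
  s_ Lam (w ++ nseq j ord0) <= expR (j%:R * cmax) * s_ Lam w.
Proof.
elim: j => [|j IH]; first by rewrite cats0 mul0r expR0 mul1r.
rewrite -/(prolong w j.+1) prolongS (le_trans (s_rcons_le cmax_lt0 LamP _ _))//.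
by rewrite -natr1 mulrDl mul1r addrC expRD -mulrA ler_wpM2l// expR_ge0.
Qed.

(** Stop at the first prolongation for which [s_] does not exceed [delta]. *)
Lemma stopping_prolongation (w : string N) (delta : R) : 0 < delta -> delta < s_ Lam w ->
  exists j, delta < s_ Lam (w ++ nseq j ord0) /\
    Defs.approx Lam (w ++ nseq j.+1 ord0) delta.
Proof.
move=> d0 dw; have s0 := s_gt0 cmax_lt0 LamP w.
have [j0 hj0] : exists j, s_ Lam (prolong w j) <= delta.
  pose k := Num.trunc ((ln (s_ Lam w) - ln delta) / - cmax); exists k.+1.
  apply: le_trans (s_prolong_le w k.+1) _.
  rewrite -[s_ Lam w]lnK ?posrE// -expRD -[delta]lnK ?posrE// ler_expR.
  have := truncnS_gt ((ln (s_ Lam w) - ln delta) / - cmax).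
  rewrite ltr_pdivrMr ?oppr_gt0// -/k; lra.
have /ex_minnP [j hj jmin] : exists j, s_ Lam (prolong w j) <= delta by exists j0.
case: j hj jmin => [|j] hj jmin.
  by move: hj; rewrite /prolong cats0 leNgt dw.
have dj : delta < s_ Lam (prolong w j).
  by rewrite ltNge; apply/negP => /jmin; rewrite ltnn.
exists j; split => //; rewrite /Defs.approx; apply/andP; split => //.
by rewrite -/(prolong w j.+1) prolongS size_rcons /= -cats1 take_size_cat.
Qed.

End stopping.

Lemma counting_ge (R : realType) (X : finType) (Y : choiceType) (T : {set X})
    (phi : X -> Y) (A : set Y) : {in T &, injective phi} ->
  (forall s, s \in T -> A (phi s)) -> (#|T|%:R%:E <= counting A :> \bar R)%E.
Proof.
move=> iphi TA; rewrite /counting; case: ifPn => [|_]; last by rewrite leey.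
rewrite inE => fA; rewrite lee_fin ler_nat.
have -> : #|T| = size [seq phi s | s <- enum T] by rewrite size_map cardE.
apply: uniq_leq_size.
  rewrite map_inj_in_uniq ?enum_uniq// => s t; rewrite !mem_enum; exact: iphi.
move=> y /mapP[s]; rewrite mem_enum => /TA As ->.
by rewrite in_fset_set// inE.
Qed.

(** * Lower bound for the spectrum *)

Section lower_bound.
Variables (N M : nat) (R : realType) (U : prob_symb N R -> 'rV[R]_M)
  (Lam : symb N -> R) (C : set 'rV[R]_M).
Hypotheses (U_cont : continuous U) (Lam_cont : continuous Lam).
Variables (cmin cmax : R).
Hypotheses (cmax_lt0 : cmax < 0) (LamP : forall x, cmin <= Lam x <= cmax).

Lemma Rintegral_bounds (mu : prob_symb N R) : cmin <= \int[mu]_x Lam x <= cmax.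
Proof.
have [n fn] := uniform_continuity_symb Lam_cont ltr01.
have mf := measurable_continuous_symb Lam_cont.
have iL : mu.-integrable setT (EFin \o Lam) by exact: (integrable_agree mu mf fn).
have ic c : mu.-integrable setT (EFin \o cst c).
  by apply: finite_measure_integrable_cst.
have cE c : \int[mu]_x cst c x = c.
  rewrite Rintegral_cst//; suff -> : fine (mu setT) = 1 by rewrite mulr1.
  by rewrite probability_setT.
apply/andP; split.
  rewrite -[leLHS]cE; apply: le_Rintegral => // x _.
  by have /andP[] := LamP x.
rewrite -[leRHS]cE; apply: le_Rintegral => // x _.
by have /andP[] := LamP x.
Qed.

Lemma empirical_visit n (x : symb N) v : (0 < n)%N ->
  cylm (empirical_prob R n x) v = n%:R^-1 * birkhoff_sum (visit R v) n x.
Proof. by move=> n0; rewrite cylm_empirical. Qed.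

(** Prolonging a word by a small proportion of its length moves its empirical
    measure by at most that proportion. *)
Lemma visit_prolongation n j (x : symb N) v p (e1 e2 : R) : 0 <= p <= 1 -> (0 < n)%N ->
  `|birkhoff_sum (visit R v) n x - n%:R * p| <= e1 * n%:R -> j%:R <= e2 * n%:R ->
  0 <= e1 -> 0 <= e2 ->
  `|cylm (empirical_prob R (n + j) x) v - p| <= e1 + e2.
Proof.
move=> /andP[p0 p1] n0 h jn e10 e20.
have nj : 0 < (n + j)%:R :> R by rewrite ltr0n addn_gt0 n0.
rewrite empirical_visit ?addn_gt0 ?n0//.
have -> : (n + j)%:R^-1 * birkhoff_sum (visit R v) (n + j) x - p =
    (birkhoff_sum (visit R v) (n + j) x - (n + j)%:R * p) / (n + j)%:R.
  by rewrite mulrBl mulrC [(n + j)%:R * p]mulrC mulfK// gt_eqF.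
rewrite normrM [X in _ * X]ger0_norm ?invr_ge0 ?(ltW nj)// ler_pdivrMr//.
rewrite birkhoff_sumD; have := birkhoff_visit_bounds R j (iter n (@left_shift N) x) v.
move: h; rewrite natrD; move: (birkhoff_sum _ n _) (birkhoff_sum _ j _) => a b.
have n0R : 0 <= n%:R :> R by []. have j0R : 0 <= j%:R :> R by [].
move: (n%:R : R) (j%:R : R) n0R j0R jn => {nj n0} n {}j n0 j0 jn.
rewrite !ler_norml => /andP[h1 h2] /andP[b0 bj]; apply/andP; split; nra.
Qed.

(** Given [delta], take typical words so short that [s_] still exceeds [delta]
    on each of them, but barely, and prolong each of them by a constant letter
    down to [delta]. As the values of [s_] on these words are exponentially
    close to each other, the prolongation is short and the empirical measures
    stay close to [mu]. Words of the same length have distinct prolongations,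
    so [N_] is at least the number of typical words. *)
Lemma lower_spectrum_at_ge (mu : prob_symb N R) (r : R) :
  shift_invariant mu -> C (U mu) -> 0 < r ->
  ((partition_entropy mu (@left_shift N) (@cylinder_partition N) /
    - \int[mu]_x Lam x)%:E <= lower_spectrum_at U Lam C r)%E.
Proof.
move=> imu CU r0; set h := partition_entropy _ _ _; set lam := \int[mu]_x Lam x.
have lam0 : 0 < - lam.
  by rewrite oppr_gt0 (le_lt_trans _ cmax_lt0)//; have /andP[] := Rintegral_bounds mu.
apply/lee_subgt0Pr => d d0; set a := h / - lam - d.
have ah : a * - lam < h by rewrite mulrBl divfK ?gt_eqF// ltrBlDr ltrDl mulr_gt0.
pose g := h - a * - lam; have g0 : 0 < g by rewrite subr_gt0.
pose kap := - cmax; have kap0 : 0 < kap by rewrite oppr_gt0.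
have [[vs1 e1] /= e10 U1] : cylinder_near mu (U @^-1` thickening C r).
  by apply: nbhs_cylinder_near; apply: U_cont; exact: nbhs_thickening.
(* eta is the tolerance on the mean of Lam. The first bound keeps the
   prolongations short with respect to e1; the second makes the loss on the
   exponent at most [g / 4]. *)
pose eta := Num.min (e1 * kap / 12) (g / (8 * (`|a| + 1))).
have a10 : 0 < `|a| + 1 by rewrite ltr_wpDl.
have eta0 : 0 < eta by rewrite lt_min !divr_gt0 ?mulr_gt0.
have eta1 : 3 * eta <= e1 / 4 * kap.
  have : eta <= e1 * kap / 12 by rewrite ge_min lexx.
  lra.
have eta2 : `|a| * (2 * eta) <= g / 4.
  have : eta <= g / (8 * (`|a| + 1)) by rewrite ge_min lexx orbT.
  rewrite ler_pdivlMr ?mulr_gt0// => h8; have : 0 <= `|a| by []; nra.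
have [[vs2 e2] /= e20 L2] := Rintegral_cylinder_near mu Lam_cont eta0.
(* Half of e1 is left for the effect of the prolongation. *)
pose e := Num.min (e1 / 2) e2.
have e0 : 0 < e by rewrite lt_min e20 divr_gt0.
have g40 : 0 < g / 4 by rewrite divr_gt0.
have [q q0 [m0 hm]] := many_typical_words imu (vs1 ++ vs2) e0 g40.
(* On the typical words, [- ln s_] is less than D per block. *)
pose D := q%:R * (- lam + 2 * eta).
have D0 : 0 < D by rewrite mulr_gt0 ?ltr0n// addr_gt0// mulr_gt0.
pose m1 := (maxn m0 (maxn (Num.trunc ((1 + D / kap) / (e1 / 4))).+1
                          (Num.trunc (`|a| * D / (g / 4))).+1)).
pose f (delta : R) := (lne (N_ U Lam delta C r) / (- ln delta)%:E)%E.
rewrite /lower_spectrum_at -/f limf_einfE; apply: le_ereal_sup_tmp.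
exists (ereal_inf (f @` [set delta | 0 < delta < expR (- (m1%:R * D))])).
  exists [set delta | 0 < delta < expR (- (m1%:R * D))] => //.
  near=> delta; apply/andP; split; first by [].
  by near: delta; apply: nbhs_right_lt; exact: expR_gt0.
apply: le_ereal_inf_tmp => _ [delta /andP[delta0 deltalt] <-]; rewrite /f.
pose L := - ln delta.
have L0 : m1%:R * D < L.
  by rewrite ltrNr -ltr_expR lnK// posrE.
have Lpos : 0 < L by rewrite (le_lt_trans _ L0)// mulr_ge0// ltW.
(* The largest number of blocks for which this bound keeps [s_] above delta. *)
pose m := Num.trunc (L / D).
have /andP[mL Lm] : m%:R * D <= L < m.+1%:R * D.
  have := truncn_itv (divr_ge0 (ltW Lpos) (ltW D0)).
  by rewrite -/m ler_pdivlMr// ltr_pdivrMr.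
have m1m : (m1 <= m)%N.
  by rewrite -ltnS -(ltr_nat R) -(ltr_pM2r D0) (lt_trans L0).
have [T [Tcard Ttyp]] := hm m (leq_trans (leq_maxl _ _) m1m).
have mpos : (0 < m)%N by rewrite (leq_trans _ m1m)// !leq_max ltn0Sn orbT.
pose n := (m * q)%N; have n0 : (0 < n)%N by rewrite muln_gt0 mpos.
have mR : 1 <= m%:R :> R by rewrite ler1n.
have nR : 0 < n%:R :> R by rewrite ltr0n.
have mn : m%:R <= n%:R :> R by rewrite ler_nat leq_pmulr.
have mD : m%:R * D = n%:R * (- lam + 2 * eta) by rewrite /n natrM mulrA.
have m2 : 1 + D / kap <= e1 / 4 * m%:R.
  rewrite [leRHS]mulrC -ler_pdivrMr ?divr_gt0// (le_trans (ltW (truncnS_gt _)))//.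
  by rewrite ler_nat (leq_trans _ m1m)// !leq_max leqnn orbT.
have m3 : `|a| * D <= g / 4 * m%:R.
  rewrite [leRHS]mulrC -ler_pdivrMr// (le_trans (ltW (truncnS_gt _)))//.
  by rewrite ler_nat (leq_trans _ m1m)// !leq_max leqnn !orbT.
have birkhoff_near (s : m.-tuple (q.-tuple 'I_N.+1)) x :
    s \in T -> cylinder (flatten (map val s)) x ->
    n%:R * (lam - eta) <= birkhoff_sum Lam n x <= n%:R * (lam + eta).
  move=> sT xs; have : `|\int[empirical_prob R n x]_y Lam y - lam| <= eta.
    apply: L2 => v v2; rewrite -[n]addn0; rewrite -[e2]addr0.
    apply: visit_prolongation => //; rewrite ?cylm_ge0 ?cylm_le1 ?mul0r ?(ltW e20)//.
    apply: le_trans (Ttyp s x v sT xs _) _; first by rewrite mem_cat v2 orbT.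
    by rewrite ler_wpM2r// ge_min lexx orbT.
  rewrite Rintegral_empirical// ler_distl mulrC !ler_pdivlMr// !ler_pdivrMr//.
  by rewrite ![_ * n%:R]mulrC.
have size_s (s : m.-tuple (q.-tuple 'I_N.+1)) : size (flatten (map val s)) = n.
  have -> : size (flatten (map val s)) = (size s * q)%N.
    by elim: (tval s) => //= b t IH; rewrite size_cat IH size_tuple mulSn.
  by rewrite size_tuple.
have s_large (s : m.-tuple (q.-tuple 'I_N.+1)) : s \in T -> delta < s_ Lam (flatten (map val s)).
  move=> sT; apply: lt_le_trans (s_ge cmax_lt0 LamP (@cylinder_pad _ _)).
  rewrite -[delta]lnK ?posrE// ltr_expR size_s.
  have /andP[+ _] := birkhoff_near s (pad _) sT (@cylinder_pad _ _).
  apply: lt_le_trans; rewrite -[ln delta]opprK -/L ltrNl (lt_le_trans _ mL)// mD -mulrN.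
  by rewrite ltr_pM2l//; lra.
have s_small (s : m.-tuple (q.-tuple 'I_N.+1)) : s \in T ->
    s_ Lam (flatten (map val s)) <= expR (n%:R * (lam + eta)).
  move=> sT; apply: s_le => x xs; rewrite ler_expR size_s.
  by have /andP[] := birkhoff_near s x sT xs.
have /choice [J JP] : forall s : m.-tuple (q.-tuple 'I_N.+1), exists j, s \in T ->
    delta < s_ Lam (flatten (map val s) ++ nseq j ord0) /\
    Defs.approx Lam (flatten (map val s) ++ nseq j.+1 ord0) delta.
  move=> s; have [sT|] := boolP (s \in T); last by exists 0%N.
  have [j hj] := stopping_prolongation cmax_lt0 LamP delta0 (s_large s sT).
  by exists j.
pose phi (s : m.-tuple (q.-tuple 'I_N.+1)) : string N :=
  flatten (map val s) ++ nseq (J s).+1 ord0.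
have J_le s : s \in T -> (J s).+1%:R <= e1 / 2 * n%:R.
  move=> sT; have [dj _] := JP s sT.
  have := lt_le_trans dj (s_prolong_le cmax_lt0 LamP _ _).
  move=> /lt_le_trans /(_ (ler_wpM2l (expR_ge0 _) (s_small s sT))).
  rewrite -expRD -[delta]lnK ?posrE// ltr_expR => hJ.
  have hJ2 : (J s)%:R * kap <= 3 * eta * n%:R + D.
    move: Lm; rewrite -natr1 mulrDl mul1r mD /kap /L => Lm; lra.
  have hJ3 : (J s)%:R <= (3 * eta * n%:R + D) / kap by rewrite ler_pdivlMr.
  have hJ4 : (3 * eta * n%:R + D) / kap <= e1 / 4 * n%:R + D / kap.
    by rewrite mulrDl lerD2r ler_pdivrMr// [leRHS]mulrAC ler_wpM2r.
  rewrite -natr1; nra.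
(* All the words have length n, so that cutting after n letters recovers s. *)
have phi_inj : {in T &, injective phi}.
  move=> s t sT tT /(congr1 (take n)); rewrite /phi !take_size_cat ?size_s//.
  move=> /(congr1 (reshape (nseq m q))).
  have sh (u : m.-tuple (q.-tuple 'I_N.+1)) : shape (map val u) = nseq m q.
    rewrite -[in RHS](size_tuple u).
    by elim: (tval u) => //= b u' IH; rewrite size_tuple IH.
  rewrite -{1}(sh s) -(sh t) !flattenK => /(inj_map val_inj) st.
  exact: val_inj.
have phi_Pi s : s \in T -> Pi_ U Lam delta C r (phi s).
  move=> sT; split.
  - by rewrite -size_eq0 size_cat size_s -lt0n addn_gt0 n0.
  - by have [_] := JP s sT.
  - move=> _ [x /cylinder_cat [xs _] <-]; apply: U1 => v v1.
    rewrite size_cat size_s size_nseq [e1]splitr.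
    apply: visit_prolongation => //; rewrite ?cylm_ge0 ?cylm_le1 ?divr_ge0 ?(ltW e10)//.
      apply: le_trans (Ttyp s x v sT xs _) _; first by rewrite mem_cat v1.
      by rewrite ler_wpM2r// ge_min lexx.
    exact: J_le.
have NT := counting_ge R phi_inj phi_Pi.
have T0 : 0 < #|T|%:R :> R by exact: lt_le_trans (expR_gt0 _) Tcard.
have aL : a * L <= ln #|T|%:R.
  have T1 : 0 <= ln (#|T|%:R : R).
    by rewrite ln_ge0// ler1n -(ltr0n R).
  have [a0|a0] := leP a 0; first by rewrite (le_trans _ T1)// mulr_le0_ge0// ltW.
  have aT : n%:R * (h - g / 4) <= ln (#|T|%:R : R).
    by rewrite -ler_expR lnK ?posrE.
  apply: le_trans aT; move: eta2 m3; rewrite gtr0_norm// => eta2 m3.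
  have : a * L <= a * (m%:R * D + D).
    by rewrite ler_wpM2l ?(ltW a0)// (le_trans (ltW Lm))// -natr1 mulrDl mul1r.
  rewrite mD; move: eta2 m3 mn; rewrite /g => eta2 m3 mn; nra.
rewrite -/L inver gt_eqF// lee_pdivlMr// -EFinM (le_trans (_ : _ <= (ln #|T|%:R)%:E)%E)//.
rewrite -lne_EFin// lee_lne//.
  by rewrite in_itv/= leey andbT lee_fin ler0n.
rewrite in_itv/= leey andbT /N_ /counting.
by case: ifP => _; rewrite ?lee_fin ?leey.
Unshelve. all: by end_near. Qed.

End lower_bound.

(** * From the abscissa to the spectrum of the inner parts *)

(** A set on which the terms of a convergent series are bounded below is
    finite, with an explicit bound on its cardinal. *)
Lemma counting_le_summable (R : realType) (Y : choiceType) (a : Y -> R) (A D : set Y)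
    (K w : R) : A `<=` D -> 0 < w -> (forall y, A y -> w <= a y) ->
  (\esum_(y in D) `|(a y)%:E| <= K%:E)%E -> (counting A <= (K / w)%:E)%E.
Proof.
move=> AD w0 wa DK.
have bound (B : seq Y) : uniq B -> [set` B] `<=` A -> (size B)%:R <= K / w.
  move=> uB BA; rewrite ler_pdivlMr// -lee_fin; apply: le_trans DK; apply: esum_ge.
  exists [set` B]; first by split => //; exact: subset_trans AD.
  rewrite -fsbig_seq// sumEFin lee_fin.
  apply: (@le_trans _ _ (\sum_(y <- B) w)).
    by rewrite big_const_seq count_predT iter_addr_0 mulr_natl.
  rewrite big_seq [leRHS]big_seq; apply: ler_sum => y yB.
  by rewrite (le_trans (wa y (BA y yB)))// ler_norm.
rewrite /counting; have [fA|infA] := pselect (finite_set A).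
  rewrite asboolT// lee_fin; apply: bound; first exact: finmap.fset_uniq.
  by move=> y /=; rewrite (in_fset_set fA) => /set_mem.
exfalso.
have [B BA nB] := infinite_set_fset (Num.trunc (K / w)).+1 infA.
have BK := bound _ (finmap.fset_uniq B) BA.
have := lt_le_trans (truncnS_gt (K / w)) (le_trans _ BK).
by rewrite ler_nat => /(_ nB); rewrite ltxx.
Qed.

Lemma counting_sub (R : realType) (Y : choiceType) (A B : set Y) : A `<=` B ->
  (counting A <= counting B :> \bar R)%E.
Proof.
move=> AB; rewrite /counting; have [fB|nB] := pselect (finite_set B).
  have fA := sub_finite_set AB fB.
  rewrite !asboolT// lee_fin ler_nat; apply: uniq_leq_size; first exact: finmap.fset_uniq.
  by move=> y; rewrite !in_fset_set// => /set_mem/AB/mem_set.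
by rewrite [in leRHS]asboolF// leey.
Qed.

Section inner_part.
Variables (R : realType) (M : nat).
Implicit Types (x y : 'rV[R]_M) (C : set 'rV[R]_M).

Lemma eucl_dist_segment x y (t : R) : 0 <= t ->
  eucl_dist y (y + t *: (x - y)) = t * eucl_dist x y.
Proof.
move=> t0; rewrite /eucl_dist.
rewrite (eq_bigr (fun j => t ^+ 2 * (x 0 j - y 0 j) ^+ 2)) => [|j _].
  by rewrite -mulr_sumr sqrtrM ?sqr_ge0// sqrtr_sqr ger0_norm.
by rewrite !mxE; ring.
Qed.

(** Take the last point of the segment, in the sense of a supremum, that
    belongs to [C]. *)
Lemma segment_meets_boundary C x y : C y -> ~ C x ->
  exists2 t : R, 0 <= t <= 1 & boundary C (y + t *: (x - y)).
Proof.
move=> Cy nCx; pose p t : 'rV[R]_M := y + t *: (x - y).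
have cp : continuous p.
  move=> t; apply: cvgD; first exact: cvg_cst.
  by apply: cvgZr_tmp; exact: cvg_id.
pose S := [set t : R | 0 <= t <= 1 /\ C (p t)].
have S0 : S 0 by split; rewrite ?lexx ?ler01// /p scale0r addr0.
have hS : has_sup S by split; [exists 0|exists 1 => t [/andP[]]].
have Sle t : S t -> t <= sup S by move=> St; apply: ub_le_sup => //; case: hS.
have t01 : 0 <= sup S <= 1.
  apply/andP; split; first exact: Sle.
  by apply: ge_sup; [exists 0|move=> t [/andP[]]].
exists (sup S) => //; rewrite -/(p _); split.
  move=> B /cp /nbhs_ballP [e /= e0 eB].
  have [t [St Ct] te] := sup_adherent e0 hS.
  exists (p t); split => //; apply: eB; rewrite /ball/= ger0_norm.
    by rewrite ltrBlDl -ltrBlDr.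
  by rewrite subr_ge0; exact: Sle.
move=> /cp /nbhs_ballP [e /= e0 eC].
have [s1|s1] := leP 1 (sup S).
  have s1' : sup S = 1 by apply/eqP; rewrite eq_le s1 andbT; have /andP[] := t01.
  apply: nCx; have : C (p (sup S)) by apply: eC; exact: ballxx.
  by rewrite s1' /p scale1r addrC subrK.
pose t := Num.min 1 (sup S + e / 2).
have ts : sup S < t by rewrite lt_min s1 ltrDl divr_gt0.
have : S t.
  split.
    by rewrite ge_min lexx andbT (le_trans _ (ltW ts))//; have /andP[] := t01.
  apply: eC; rewrite /ball/= distrC ger0_norm ?subr_ge0 ?(ltW ts)// ltrBlDl.
  by rewrite gt_min; apply/orP; right; rewrite ltrD2l ltr_pdivrMr// ltr_pMr// ltr1n.
by move=> /Sle; rewrite leNgt ts.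
Qed.

(** A segment from a point of the inner part to a point outside [C] meets the
    boundary, hence is longer than [r]. *)
Lemma thickening_inner_part C (r : R) : 0 < r ->
  thickening (inner_part C r) (r / 2) `<=` C.
Proof.
move=> r0 x xr; apply: contrapT => nCx.
have : (dist_to x (inner_part C r) < r%:E)%E.
  by apply: le_lt_trans xr _; rewrite lte_fin ltr_pdivrMr// ltr_pMr// ltr1n.
move=> /ereal_inf_lt [_ [y [Cy yb] <-]]; rewrite lte_fin => xy.
have [t /andP[t0 t1] tb] := segment_meets_boundary Cy nCx.
have := le_trans yb (dist_to_le y tb); rewrite lee_fin eucl_dist_segment//.
have d0 : 0 <= eucl_dist x y by exact: sqrtr_ge0.
nra.
Qed.

End inner_part.

Section spectrum.
Variables (N M : nat) (R : realType) (U : prob_symb N R -> 'rV[R]_M)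
  (Lam : symb N -> R).
Implicit Type C : set 'rV[R]_M.

Lemma near_delta01 : \forall d \near (0 : R)^'+, 0 < d < 1.
Proof.
near=> d; apply/andP; split; first by [].
by near: d; exact: nbhs_right_lt.
Unshelve. all: by end_near. Qed.

Lemma lower_spectrum_at_mono C r r' : r <= r' ->
  (lower_spectrum_at U Lam C r <= lower_spectrum_at U Lam C r')%E.
Proof.
move=> rr'; rewrite /lower_spectrum_at !limf_einfE.
apply: ge_ereal_sup => _ [V V0 <-]; apply: le_ereal_sup_tmp.
eexists; first by exists (V `&` [set d | 0 < d < 1]) => //; exact: filterI V0 near_delta01.
apply: le_ereal_inf_tmp => _ [d [Vd /andP[d0 d1]] <-].
apply: (@le_trans _ _ (lne (N_ U Lam d C r) / (- ln d)%:E)%E).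
  by apply: ereal_inf_lbound; exists d.
have ld : 0 < - ln d by rewrite oppr_gt0 ln_lt0// d0.
rewrite inver gt_eqF//; apply: lee_wpmul2r; first by rewrite lee_fin invr_ge0 ltW.
have N0 s : N_ U Lam d C s \in `[0%E, +oo%E].
  by rewrite in_itv/= leey andbT /N_ /counting; case: ifP => _; rewrite ?lee_fin ?leey.
rewrite lee_lne//; apply: counting_sub => w [w0 wd wC]; split => //.
by move=> x /wC; rewrite /thickening/= => /le_trans; apply; rewrite lee_fin.
Qed.

(** The spectrum is monotone in the radius, so its limit is an infimum. *)
Lemma lower_spectrumE C : lower_spectrum U Lam C =
  ereal_inf [set lower_spectrum_at U Lam C r | r in `]0, +oo[].
Proof.
apply/cvg_lim => //.
apply: (@nondecreasing_at_right_cvge R (lower_spectrum_at U Lam C) 0 (BInfty R false)).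
  by [].
by move=> r r' _ _; exact: lower_spectrum_at_mono.
Qed.

Variables (cmin cmax c : R).
Hypotheses (cmax_lt0 : cmax < 0) (LamP : forall x, cmin <= Lam x <= cmax).
Hypotheses (c_ge1 : 1 <= c) (LamC3 : forall (n : nat) (x y : symb N), (0 < n)%N ->
    (forall k, (k < n)%N -> x k = y k) ->
    c^-1 <= expR (birkhoff_sum Lam n x) / expR (birkhoff_sum Lam n y) <= c).

Lemma approx_s_ge (w : string N) (delta : R) : w != [::] -> Defs.approx Lam w delta ->
  expR cmin / c * delta <= s_ Lam w <= delta.
Proof.
move=> w0 /andP[wd dw]; rewrite wd andbT.
have c0 : 0 < c by exact: lt_le_trans c_ge1.
case/lastP: w w0 wd dw => // w a _ wd; rewrite size_rcons /= -cats1 take_size_cat// cats1 => dw.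
apply: le_trans (s_rcons_ge cmax_lt0 LamP c_ge1 LamC3 w a).
by rewrite ler_wpM2l ?(ltW dw)// divr_ge0 ?expR_ge0 ?(ltW c0).
Qed.

(** The strings counted for the inner part with radius [rho / 2] are terms of
    the series for [C]. Each of them has [s_] of order [delta], so that a sum
    of at most [K] allows a number of them of order [delta `^ (- t)]. *)
Lemma lower_spectrum_inner_le C t (rho : R) : 0 < rho ->
  summable (zeta_strings U C) (fun w => (s_ Lam w `^ t)%:E) ->
  (lower_spectrum U Lam (inner_part C rho) <= t%:E)%E.
Proof.
move=> rho0 sumt; have rho20 : 0 < rho / 2 by rewrite divr_gt0.
have c0 : 0 < c by exact: lt_le_trans c_ge1.
rewrite lower_spectrumE.
apply: (@le_trans _ _ (lower_spectrum_at U Lam (inner_part C rho) (rho / 2))).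
  by apply: ereal_inf_lbound; exists (rho / 2) => //; rewrite /= in_itv/= andbT.
pose K := fine (\esum_(w in zeta_strings U C) `|(s_ Lam w `^ t)%:E|)%E.
have KE : (\esum_(w in zeta_strings U C) `|(s_ Lam w `^ t)%:E| = K%:E)%E.
  by rewrite fineK//; rewrite summableE in sumt.
have K0 : 0 <= K by apply: fine_ge0; apply: esum_ge0.
(* As [s_] lies between [delta * expR cmin / c] and delta, [s_ `^ t] is at
   least [delta `^ t * expR (- b)], whatever the sign of t. *)
pose b := `|t * ln (expR cmin / c)|.
have Nle delta : 0 < delta < 1 ->
    (lne (N_ U Lam delta (inner_part C rho) (rho / 2)) <=
     (ln (K + 1) + b + t * - ln delta)%:E)%E.
  move=> /andP[d0 d1].
  have e0 : 0 < expR (t * ln delta - b) by exact: expR_gt0.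
  have NK : (N_ U Lam delta (inner_part C rho) (rho / 2) <=
      (K / expR (t * ln delta - b))%:E)%E.
    apply: (@counting_le_summable _ _ (fun w => s_ Lam w `^ t) _ (zeta_strings U C)) => //.
    - move=> w [w0 _ wC]; split => //.
      exact: subset_trans wC (thickening_inner_part rho0).
    - move=> w [w0 wd _]; have /andP[w1 w2] := approx_s_ge w0 wd.
      have s0 := s_gt0 cmax_lt0 LamP w.
      rewrite /powR gt_eqF// ler_expR.
      have l1 : ln (expR cmin / c) + ln delta <= ln (s_ Lam w).
        by rewrite -lnM ?posrE ?divr_gt0 ?expR_gt0// ler_ln ?posrE// mulr_gt0// divr_gt0 ?expR_gt0.
      have l2 : ln (s_ Lam w) <= ln delta by rewrite ler_ln ?posrE.
      rewrite /b; have := ler_norm (t * ln (expR cmin / c)).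
      have := ler_norm (- (t * ln (expR cmin / c))); rewrite normrN.
      have := normr_ge0 (t * ln (expR cmin / c)).
      move: (ln (expR cmin / c)) (ln delta) (ln (s_ Lam w)) l1 l2 => k d s.
      move: `|_| => B l1 l2 h0 h1 h2.
      have [t0|t0] := leP 0 t; nra.
    - by rewrite KE.
  have NK1 : (N_ U Lam delta (inner_part C rho) (rho / 2) <=
      (expR (ln (K + 1) + b + t * - ln delta))%:E)%E.
    apply: le_trans NK _; rewrite lee_fin ler_pdivrMr// -expRD.
    rewrite (_ : _ + _ = ln (K + 1)); last by ring.
    by rewrite lnK ?posrE ?ltr_wpDl// lerDl.
  rewrite -[X in (_ <= X%:E)%E]expRK -lne_EFin ?expR_gt0//.
  rewrite lee_lne//.
    by rewrite in_itv/= leey andbT /N_ /counting; case: ifP => _; rewrite ?lee_fin ?leey.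
  by rewrite in_itv/= leey andbT lee_fin expR_ge0.
apply/lee_addgt0Pr => e e0; rewrite /lower_spectrum_at limf_einfE.
apply: ge_ereal_sup => _ [V V0 <-].
(* For [- ln d] larger than [B / e], the constants contribute less than e to
   the quotient. *)
pose B := `|ln (K + 1) + b| + 1.
have B0 : 0 < B by rewrite ltr_wpDl.
have small : \forall d \near (0 : R)^'+, d < expR (- (B / e)).
  by apply: nbhs_right_lt; exact: expR_gt0.
have [d [[Vd /andP[d0 d1]] /= dB]] := filter_ex (filterI (filterI V0 near_delta01) small).
apply: (@le_trans _ _ (lne (N_ U Lam d (inner_part C rho) (rho / 2)) / (- ln d)%:E)%E).
  by apply: ereal_inf_lbound; exists d.
have ld : 0 < - ln d by rewrite oppr_gt0 ln_lt0// d0.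
rewrite inver gt_eqF// lee_pdivrMr// (le_trans (Nle d _)) ?d0//.
rewrite -EFinD -EFinM lee_fin mulrDl [leRHS]addrC lerD2r.
have : B <= e * - ln d.
  rewrite mulrC -ler_pdivrMr// lerNr -ler_expR lnK ?posrE//; exact: ltW.
by apply: le_trans; rewrite (le_trans (ler_norm _))// lerDl.
Unshelve. all: by end_near. Qed.

End spectrum.

(** * The two formulas *)

Lemma ereal_lt_dense_EFin (R : realType) (x y : \bar R) : (x < y)%E ->
  exists t : R, (x < t%:E < y)%E.
Proof.
case: x y => [x| |] [y| |] //=.
- rewrite lte_fin => xy; exists ((x + y) / 2); rewrite !lte_fin.
  by rewrite midf_lt//= midf_lt.
- by move=> _; exists (x + 1); rewrite lte_fin ltrDl ltr01 ltry.
- by move=> _; exists (y - 1); rewrite ltNyr lte_fin gtrBl ltr01.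
- by move=> _; exists 0; rewrite ltNyr ltry.
Qed.

Unset Implicit Arguments.
Set Strict Implicit.
Set Printing Implicit Defensive.

Theorem theorem2p2 (R : realType) (N M : nat) (M_gt0 : (0 < M)%N)
    (U : prob_symb N R -> 'rV[R]_M) (U_cont : continuous U)
    (Lam : symb N -> R) (C1 : continuous Lam) (C2 : cond_C2 Lam)
    (C3 : cond_C3 Lam)
    (C : set 'rV[R]_M) (C_closed : closed C)
    (C_inner : inner_continuous (lower_spectrum U Lam) C) :
  zeta_abscissa U Lam C = lower_spectrum U Lam C
  /\
  zeta_abscissa U Lam C =
    ereal_sup [set (- (entropy mu (@left_shift N) / (\int[mu]_x Lam x)%:E))%E
              | mu in [set mu : prob_symb N R |
                         shift_invariant mu /\ C (U mu)]].
Proof.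
have [cmin [cmax [_ cmax_lt0 LamP]]] := C2.
have [c c_ge1 LamC3] := C3.
have lam_lt0 (mu : prob_symb N R) : \int[mu]_x Lam x < 0.
  by have /andP[_ /le_lt_trans->] := Rintegral_bounds C1 LamP mu.
set V := ereal_sup _.
have valueE (mu : prob_symb N R) : shift_invariant mu ->
    (- (entropy mu (@left_shift N) / (\int[mu]_x Lam x)%:E))%E =
    (partition_entropy mu (@left_shift N) (@cylinder_partition N) /
      - \int[mu]_x Lam x)%:E.
  move=> imu; rewrite entropy_cylinder// inver lt_eqF// -EFinM -EFinN.
  by rewrite invrN mulrN.
have zeta_le : (zeta_abscissa U Lam C <= V)%E.
  rewrite leNgt; apply/negP => /ereal_lt_dense_EFin [t /andP[Vt tz]].
  have : (zeta_abscissa U Lam C <= t%:E)%E.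
    apply: ereal_inf_lbound; exists t => //.
    apply: (zeta_summable U_cont C1 C_closed cmax_lt0 LamP c_ge1 LamC3).
    move=> mu imu CU; have : (- (entropy mu (@left_shift N) / (\int[mu]_x Lam x)%:E) <= V)%E.
      by apply: ereal_sup_ubound; exists mu.
    move=> /le_lt_trans /(_ Vt); rewrite valueE// lte_fin.
    by rewrite ltr_pdivrMr ?oppr_gt0// mulrN -subr_lt0 opprK.
  by rewrite leNgt tz.
have le_zeta : (lower_spectrum U Lam C <= zeta_abscissa U Lam C)%E.
  apply: le_ereal_inf_tmp => _ [t sumt <-].
  apply: (closed_cvg [set x : \bar R | (x <= t%:E)%E]) C_inner.
    exact: closed_ereal_ge_ereal.
  near=> r; apply: (lower_spectrum_inner_le cmax_lt0 LamP c_ge1 LamC3) => //.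
have V_le : (V <= lower_spectrum U Lam C)%E.
  apply: ge_ereal_sup => _ [mu [imu CU] <-]; rewrite valueE// lower_spectrumE.
  apply: le_ereal_inf_tmp => _ [r /= + <-]; rewrite in_itv/= andbT => r0.
  exact: (lower_spectrum_at_ge U_cont C1 cmax_lt0 LamP).
split; apply/eqP; rewrite eq_le.
  by rewrite (le_trans zeta_le).
by rewrite zeta_le (le_trans V_le).
Unshelve. all: by end_near. Qed.
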